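(* Let $\varsigma,\tau,\delta,\zeta,\lambda\in\mathbb{T}$ with $|\operatorname{Im}_j(\varsigma)|<\operatorname{Re}(\varsigma)$, $|\operatorname{Im}_j(\tau)|<\operatorname{Re}(\tau)$ and $|\operatorname{Im}_j(\delta)|<\operatorname{Re}(\delta)$. Then $$\int_{\Gamma}t^{\tau-1}\,\mathbb{E}^{\delta}_{\varsigma,\tau}(\lambda t^{\varsigma})\,dt=\zeta^{\tau}\,\mathbb{E}^{\delta}_{\varsigma,\tau+1}(\lambda\zeta^{\varsigma}),$$ where $\Gamma=(\Gamma_1,\Gamma_2)$, $\Gamma_1$ is a path from $0$ to $\zeta_1$ and $\Gamma_2$ is a path from $0$ to $\zeta_2$, with $\zeta=\zeta_1e_1+\zeta_2e_2$.
   Context: $\mathbb{T}=\{x_0+i_1x_1+i_2x_2+jx_3: x_0,\dots,x_3\in\mathbb{R}\}$ is the commutative algebra of bicomplex numbers, with $i_1^2=i_2^2=-1$, $j=i_1i_2=i_2i_1$, $j^2=1$; write $\operatorname{Re}=x_0$, $\operatorname{Im}_j=x_3$. $\mathbb{C}$ is identified with $\{x_0+i_1x_1\}$. With $e_1=\frac{1+i_1i_2}{2}$, $e_2=\frac{1-i_1i_2}{2}$, every $\xi=w_1+i_2w_2$ ($w_1,w_2\in\mathbb{C}$) is uniquely $\xi=\xi_1e_1+\xi_2e_2$ with $\xi_1=w_1-i_1w_2$, $\xi_2=w_1+i_1w_2\in\mathbb{C}$; algebraic operations, limits and $\Gamma(\cdot)$ (the Gamma function) are componentwise. Bicomplex integrals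 along $\Gamma=(\Gamma_1,\Gamma_2)$ are componentwise: $\int_\Gamma f(t)\,dt=\int_{\Gamma_1}f_1(t_1)\,dt_1\,e_1+\int_{\Gamma_2}f_2(t_2)\,dt_2\,e_2$ for $f(t)=f_1(t_1)e_1+f_2(t_2)e_2$. Powers are $t^{\eta}=t_1^{\eta_1}e_1+t_2^{\eta_2}e_2$ with $t_r^{\eta_r}=\exp(\eta_r\log t_r)$, one branch of $\log$ (continuous along $\Gamma_r$ away from $0$) being used on both sides (e.g. the straight segment from $0$ to $\zeta_r$ and the principal branch). The bicomplex Prabhakar function is $$\mathbb{E}_{\varsigma,\tau}^{\delta}(\zeta)=\sum_{k=0}^{\infty}\frac{(\delta)_k}{k!\,\Gamma(\varsigma k+\tau)}\zeta^k,\qquad (\delta)_k=\delta(\delta+1)\cdots(\delta+k-1),\ (\delta)_0=1.$$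
   Formalization: Paths are piecewise C^1, meet 0 only at finitely many parameters or along whole arcs, and the chosen log has bounded imaginary part; otherwise false: t=s^2 exp(4i ln s), tau=1+i, lambda=0 gives a divergent integral. *)

(* Defs.v *)
From Stdlib Require Import Reals Lra Factorial.
From Coquelicot Require Import Coquelicot.
Open Scope R_scope.

(** * Complex preliminaries *)

Definition Cexp (z : C) : C := (exp (Re z) * cos (Im z), exp (Re z) * sin (Im z)).

(** Limits and sums of complex sequences, through real and imaginary parts;
    like Coquelicot's [Lim_seq] and [Series] they are total, and meaningful
    only in case of convergence. *)
Definition CLim_seq (u : nat -> C) : C :=
  (real (Lim_seq (fun n => Re (u n))), real (Lim_seq (fun n => Im (u n)))).

Definition CSeries (a : nat -> C) : C :=
  (Series (fun n => Re (a n)), Series (fun n => Im (a n))).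

(** Rising factorial [z (z+1) ... (z+k-1)]. *)
Fixpoint Cpochhammer (z : C) (k : nat) : C :=
  match k with
  | O => 1%C
  | S k' => (Cpochhammer z k' * (z + RtoC (INR k')))%C
  end.

(** Gamma function, by the Euler-Gauss limit
    [Gamma z = lim n! n^z / (z (z+1) ... (z+n))], which converges at every
    [z] other than the poles [0, -1, -2, ...]. *)
Definition CGamma (z : C) : C :=
  CLim_seq (fun n =>
    (RtoC (INR (fact n)) * Cexp (z * RtoC (ln (INR n)))
       / Cpochhammer z (S n))%C).

(** The power [z^eta = exp (eta log z)], where [l] is the value of [log z] in
    the branch in use. The logarithm has no value at [0]; there the power is
    [0], its limit when [0 < Re eta]. *)
Definition Cpower (z l eta : C) : C :=
  if Ceq_dec z 0%C then 0%C else Cexp (eta * l)%C.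

(** * Bicomplex numbers [x0 + i1 x1 + i2 x2 + j x3] *)

Record bicomplex := Bicomplex { Bre : R; Bim1 : R; Bim2 : R; Bimj : R }.

Declare Scope bicomplex_scope.
Delimit Scope bicomplex_scope with T.
Bind Scope bicomplex_scope with bicomplex.

(** [x = w1 + i2 w2]; recall [j = i1 i2], so that [i2 w2 = i2 x2 + j x3]. *)
Definition Bw1 (x : bicomplex) : C := (Bre x, Bim1 x).
Definition Bw2 (x : bicomplex) : C := (Bim2 x, Bimj x).
Definition Bpair (w1 w2 : C) : bicomplex := Bicomplex (Re w1) (Im w1) (Re w2) (Im w2).

Definition Binj (z : C) : bicomplex := Bpair z 0%C.
Definition Bplus (x y : bicomplex) : bicomplex :=
  Bpair (Bw1 x + Bw1 y)%C (Bw2 x + Bw2 y)%C.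
Definition Bminus (x y : bicomplex) : bicomplex :=
  Bpair (Bw1 x - Bw1 y)%C (Bw2 x - Bw2 y)%C.
Definition Bmult (x y : bicomplex) : bicomplex :=
  Bpair (Bw1 x * Bw1 y - Bw2 x * Bw2 y)%C (Bw1 x * Bw2 y + Bw2 x * Bw1 y)%C.

Definition BofR (r : R) : bicomplex := Binj (RtoC r).
Definition Bone : bicomplex := BofR 1.

Infix "+" := Bplus : bicomplex_scope.
Infix "-" := Bminus : bicomplex_scope.
Infix "*" := Bmult : bicomplex_scope.

Definition Be1 : bicomplex := Bicomplex (1 / 2) 0 0 (1 / 2).
Definition Be2 : bicomplex := Bicomplex (1 / 2) 0 0 (- (1 / 2)).

(** Idempotent components [x = x_1 e1 + x_2 e2]. *)
Definition Bcomp1 (x : bicomplex) : C := (Bw1 x - Ci * Bw2 x)%C.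
Definition Bcomp2 (x : bicomplex) : C := (Bw1 x + Ci * Bw2 x)%C.
Definition Bidem (z1 z2 : C) : bicomplex := (Binj z1 * Be1 + Binj z2 * Be2)%T.

Ltac bicomplex_tac :=
  repeat match goal with x : bicomplex |- _ => destruct x end;
  repeat match goal with z : C |- _ => destruct z end;
  cbv [Bidem Bcomp1 Bcomp2 Be1 Be2 Bone BofR Bplus Bminus Bmult Binj Bpair Bw1 Bw2
       Bre Bim1 Bim2 Bimj Cplus Cminus Cmult Copp Ci Re Im RtoC fst snd];
  f_equal; field.

Lemma Bidem_comp (x : bicomplex) : Bidem (Bcomp1 x) (Bcomp2 x) = x.
Proof. bicomplex_tac. Qed.

Lemma Bcomp1_idem (z1 z2 : C) : Bcomp1 (Bidem z1 z2) = z1.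
Proof. bicomplex_tac. Qed.

Lemma Bcomp2_idem (z1 z2 : C) : Bcomp2 (Bidem z1 z2) = z2.
Proof. bicomplex_tac. Qed.

Lemma Bcomp1_plus (x y : bicomplex) : Bcomp1 (x + y) = (Bcomp1 x + Bcomp1 y)%C.
Proof. bicomplex_tac. Qed.

Lemma Bcomp2_plus (x y : bicomplex) : Bcomp2 (x + y) = (Bcomp2 x + Bcomp2 y)%C.
Proof. bicomplex_tac. Qed.

Lemma Bcomp1_minus (x y : bicomplex) : Bcomp1 (x - y) = (Bcomp1 x - Bcomp1 y)%C.
Proof. bicomplex_tac. Qed.

Lemma Bcomp2_minus (x y : bicomplex) : Bcomp2 (x - y) = (Bcomp2 x - Bcomp2 y)%C.
Proof. bicomplex_tac. Qed.

Lemma Bcomp1_mult (x y : bicomplex) : Bcomp1 (x * y) = (Bcomp1 x * Bcomp1 y)%C.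
Proof. bicomplex_tac. Qed.

Lemma Bcomp2_mult (x y : bicomplex) : Bcomp2 (x * y) = (Bcomp2 x * Bcomp2 y)%C.
Proof. bicomplex_tac. Qed.

Lemma Bcomp1_R (r : R) : Bcomp1 (BofR r) = RtoC r.
Proof. bicomplex_tac. Qed.

Lemma Bcomp2_R (r : R) : Bcomp2 (BofR r) = RtoC r.
Proof. bicomplex_tac. Qed.

(** The inverse is meaningful when neither component vanishes. *)
Definition Binv (x : bicomplex) : bicomplex := Bidem (/ Bcomp1 x)%C (/ Bcomp2 x)%C.

Infix "/" := (fun x y => Bmult x (Binv y)) : bicomplex_scope.

Fixpoint Bpow (x : bicomplex) (k : nat) : bicomplex :=
  match k with
  | O => Bone
  | S k' => (x * Bpow x k')%T
  end.

Definition BSeries (a : nat -> bicomplex) : bicomplex :=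
  Bidem (CSeries (fun k => Bcomp1 (a k))) (CSeries (fun k => Bcomp2 (a k))).

Definition BGamma (x : bicomplex) : bicomplex :=
  Bidem (CGamma (Bcomp1 x)) (CGamma (Bcomp2 x)).

(** [x^eta], where the components of [l] are the values of the logarithms of
    the components of [x]. *)
Definition Bpower (x l eta : bicomplex) : bicomplex :=
  Bidem (Cpower (Bcomp1 x) (Bcomp1 l) (Bcomp1 eta))
        (Cpower (Bcomp2 x) (Bcomp2 l) (Bcomp2 eta)).

Fixpoint Bpochhammer (x : bicomplex) (k : nat) : bicomplex :=
  match k with
  | O => Bone
  | S k' => (Bpochhammer x k' * (x + BofR (INR k')))%T
  end.

Definition prabhakar (sigma tau delta x : bicomplex) : bicomplex :=
  BSeries (fun k =>
    (Bpochhammer delta k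
       / (BofR (INR (fact k)) * BGamma (sigma * BofR (INR k) + tau))
       * Bpow x k)%T).

(** * Paths, branches of the logarithm, path integrals *)

(** A piecewise C^1 path in the complex plane, parametrised by [0,1]; its
    [k]-th arc is its restriction to [[knot k, knot (k+1)]]. *)
Record path (a b : C) := Path {
  curve :> R -> C;
  narcs : nat;
  knot : nat -> R;
  velocity : nat -> R -> C;
  path_start : curve 0 = a;
  path_end : curve 1 = b;
  knot_first : knot 0%nat = 0;
  knot_last : knot narcs = 1;
  knot_incr : forall k, (k < narcs)%nat -> knot k < knot (S k);
  path_cont : continuous_on (fun s => 0 <= s <= 1) curve;
  path_derive : forall k s, (k < narcs)%nat -> knot k < s < knot (S k) ->
    @is_derive R_AbsRing C_R_NormedModule curve s (velocity k s);
  velocity_cont : forall k, (k < narcs)%nat ->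
    continuous_on (fun s => knot k <= s <= knot (S k)) (velocity k)
}.

(** [l s] is the value at [g s] of a branch of the logarithm that is continuous
    along the path, away from [0].

    The last two conditions hold for every path made of regular arcs (nonzero
    velocity up to the end points) and for every segment, once the parameters
    where the path meets [0] are taken as knots. They exclude paths that reach
    [0] infinitely often or while spiralling around it infinitely many times:
    for those [t^eta] may be unbounded near [0] even if [0 < Re eta], as is
    [g(s)^eta] for [g(s) = s^2 exp (i c ln s)] when [2 Re eta < c Im eta], and
    [t^(eta-1)] need not have an integral along the path. *)
Record log_branch {a b : C} (g : path a b) (l : R -> C) : Prop := {
  log_branch_exp : forall s, 0 <= s <= 1 -> g s <> 0%C -> Cexp (l s) = g s;
  log_branch_cont : continuous_on (fun s => 0 <= s <= 1 /\ g s <> 0%C) l;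
  log_branch_zeros : forall k, (k < narcs _ _ g)%nat ->
    (forall s, knot _ _ g k < s < knot _ _ g (S k) -> g s <> 0%C) \/
    (forall s, knot _ _ g k < s < knot _ _ g (S k) -> g s = 0%C);
  log_branch_bounded : exists M : R,
    forall s, 0 <= s <= 1 -> g s <> 0%C -> Rabs (Im (l s)) <= M
}.

Fixpoint Csum (n : nat) (u : nat -> C) : C :=
  match n with
  | O => 0%C
  | S m => (Csum m u + u m)%C
  end.

(** [v] is the integral along [g] of a function whose value at the point [g s]
    is [f s]. The integral over each arc is improper at both ends, because
    [t^(eta-1)] may be singular where the path meets [0]. *)
Definition is_path_integral {a b : C} (g : path a b) (f : R -> C) (v : C) : Prop :=
  exists I : nat -> C,
    (forall k, (k < narcs _ _ g)%nat ->
       @is_RInt_gen C_R_NormedModule (fun s => (f s * velocity _ _ g k s)%C)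
         (at_right (knot _ _ g k)) (at_left (knot _ _ g (S k))) (I k)) /\
    v = Csum (narcs _ _ g) I.

(** Bicomplex integral along [(g1, g2)], where [f s] is the value of the
    integrand at [g1 s e1 + g2 s e2]. *)
Definition is_bicomplex_integral {a1 b1 a2 b2 : C} (g1 : path a1 b1) (g2 : path a2 b2)
    (f : R -> bicomplex) (v : bicomplex) : Prop :=
  exists v1 v2 : C,
    is_path_integral g1 (fun s => Bcomp1 (f s)) v1 /\
    is_path_integral g2 (fun s => Bcomp2 (f s)) v2 /\
    v = Bidem v1 v2.

(* Main.v *)
(** Componentwise the claim is about one complex path. With
    [Gamma (mu + 1) = mu Gamma mu], the function
    [Phi s = t^tau E_{sigma,tau+1} (lambda t^sigma)] at [t = g s] is, away from [t = 0], the
    exponential series [sum_k c_k exp (mu_k l s)], [mu_k = sigma k + tau], in the branch [l] of the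
    logarithm, and termwise differentiation shows that it is a primitive of the integrand. It
    extends continuously by [0] to the parameters where the path meets [0], because
    [0 < Re tau] and [Im (l s)] is bounded; so the improper integrals over the arcs are
    increments of [Phi], and they telescope. Convergence rests on a lower bound for
    [|Gamma|] on cones [|Im w| <= c Re w], read off Gauss's product. *)

Require Import Defs.
From Stdlib Require Import Reals Lra Lia Factorial.
From Coquelicot Require Import Coquelicot.
Open Scope R_scope.

(** * Complex limits, series and exponential *)

(** The primitive is studied in the logarithmic variable: as a function of [l] alone it is an entire
    series of exponentials, so no branch cut enters its differentiation. Two obstacles shape the
    rest. A branch [l] is only assumed continuous; its derivative [g'/g] has to be recovered from
    [Cexp (l s) = g s]. And [CGamma] is a bare limit, whose convergence, recurrence and size must
    all come from Gauss's product. Size is the delicate point: [1 / |Gamma (mu_k + 1)|] must decay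
    faster than every [exp (- A k)]. Stirling's formula is bypassed as follows. For real [x >= 1]
    the terms [n! (n+1)^x / (x (x+1) ... (x+n))] increase with [n], so every later term is at least
    the [m]-th, which is [(m+1)^x] over a polynomial in [x] and beats any prescribed exponential
    once [m] is large. The numbers [mu_k + 1] stay in a cone, where passing from [x] to [x + i y]
    costs only a factor [exp (C x)], absorbed by a larger [m]. *)

Lemma filterlim_Cmod {T : Type} (F : (T -> Prop) -> Prop) {FF : Filter F} (f : T -> C) (z : C) :
  filterlim f F (locally z) <->
  forall eps : posreal, F (fun x => Cmod (f x - z)%C < eps).
Proof.
  split.
  - intros H eps.
    (* Halving [eps] leaves room for the factor [sqrt 2] between product balls and the modulus. *)
    apply (filterlim_locally f z) with (eps := pos_div_2 eps) in H.
    revert H; apply filter_imp; intros x Hx.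
    apply C_NormedModule_mixin_compat2 in Hx; simpl in Hx.
    apply Rlt_le_trans with (1 := Hx).
    assert (sqrt 2 <= 2).
    { rewrite <- (sqrt_Rsqr 2) at 2 by lra; apply sqrt_le_1; unfold Rsqr; lra. }
    generalize (cond_pos eps); nra.
  - intros H; apply filterlim_locally; intros eps.
    generalize (H eps); apply filter_imp; intros x Hx.
    now apply C_NormedModule_mixin_compat1.
Qed.

Lemma im_le_Cmod (z : C) : Rabs (Im z) <= Cmod z.
Proof.
  eapply Rle_trans; [| apply Rmax_Cmod]; apply Rmax_r.
Qed.

Lemma Cmod_le_Re_Im (z : C) : Cmod z <= Rabs (Re z) + Rabs (Im z).
Proof.
  replace z with (RtoC (Re z) + Ci * RtoC (Im z))%C at 1.
  2: destruct z; cbv [Cplus Cmult Ci Re Im RtoC fst snd]; f_equal; ring.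
  eapply Rle_trans; [apply Cmod_triangle|].
  rewrite Cmod_mult, Cmod_Ci, !Cmod_R; lra.
Qed.

Lemma filterlim_C_iff {T : Type} (F : (T -> Prop) -> Prop) {FF : Filter F} (f : T -> C) (z : C) :
  filterlim f F (locally z) <->
  filterlim (fun x => Re (f x)) F (locally (Re z)) /\
  filterlim (fun x => Im (f x)) F (locally (Im z)).
Proof.
  split.
  - intros H; split; apply filterlim_locally; intros eps;
      apply (filterlim_locally f z) with (eps := eps) in H;
      revert H; apply filter_imp; intros x [H1 H2]; assumption.
  - intros [H1 H2]; apply filterlim_locally; intros eps.
    apply (filterlim_locally _ (Re z)) with (eps := eps) in H1.
    apply (filterlim_locally _ (Im z)) with (eps := eps) in H2.
    generalize (filter_and _ _ H1 H2); apply filter_imp; intros x [H3 H4]; now split.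
Qed.

Lemma filterlim_Cmult {T : Type} (F : (T -> Prop) -> Prop) {FF : Filter F} (f g : T -> C)
    (z w : C) :
  filterlim f F (locally z) -> filterlim g F (locally w) ->
  filterlim (fun x => f x * g x)%C F (locally (z * w)%C).
Proof.
  intros Hf Hg.
  apply filterlim_C_iff in Hf; [|exact FF]; apply filterlim_C_iff in Hg; [|exact FF].
  destruct Hf as [f1 f2], Hg as [g1 g2].
  assert (M : forall (u v : T -> R) a b, filterlim u F (locally a) -> filterlim v F (locally b) ->
     filterlim (fun x => u x * v x) F (locally (a * b))).
  { intros u v a b Hu Hv.
    exact (filterlim_comp_2 u v Rmult Hu Hv (filterlim_mult (K := R_AbsRing) a b)). }
  apply filterlim_C_iff; [exact FF|]; split.
  - refine (filterlim_comp_2 (fun x => Re (f x) * Re (g x)) (fun x => - (Im (f x) * Im (g x)))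
      Rplus (M _ _ _ _ f1 g1) _ (filterlim_plus (V := R_NormedModule) _ _)).
    exact (filterlim_comp _ _ _ _ Ropp _ _ _ (M _ _ _ _ f2 g2)
      (filterlim_opp (V := R_NormedModule) _)).
  - exact (filterlim_comp_2 _ _ Rplus (M _ _ _ _ f1 g2) (M _ _ _ _ f2 g1)
      (filterlim_plus (V := R_NormedModule) _ _)).
Qed.

Lemma sum_n_C (a : nat -> C) (n : nat) :
  @sum_n C_AbelianMonoid a n = (sum_n (fun k => Re (a k)) n, sum_n (fun k => Im (a k)) n).
Proof.
  induction n as [|n IH].
  - rewrite !sum_O; now destruct (a 0%nat).
  - rewrite !sum_Sn, IH; now destruct (a (S n)).
Qed.

Lemma is_series_C_iff (a : nat -> C) (l : C) :
  @is_series C_AbsRing C_NormedModule a l <->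
  is_series (fun n => Re (a n)) (Re l) /\ is_series (fun n => Im (a n)) (Im l).
Proof.
  unfold is_series.
  rewrite (filterlim_C_iff eventually).
  split; intros [H1 H2]; split;
    (eapply filterlim_ext; [| eassumption]); intros n.
  - exact (f_equal Re (sum_n_C a n)).
  - exact (f_equal Im (sum_n_C a n)).
  - exact (eq_sym (f_equal Re (sum_n_C a n))).
  - exact (eq_sym (f_equal Im (sum_n_C a n))).
Qed.

Lemma CSeries_unique (a : nat -> C) (l : C) :
  @is_series C_AbsRing C_NormedModule a l -> CSeries a = l.
Proof.
  intros H; apply is_series_C_iff in H; destruct H as [H1 H2].
  unfold CSeries; rewrite (is_series_unique _ _ H1), (is_series_unique _ _ H2).
  now destruct l.
Qed.

Lemma is_series_CSeries (a : nat -> C) :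
  ex_series (fun n => Cmod (a n)) -> @is_series C_AbsRing C_NormedModule a (CSeries a).
Proof.
  intros H.
  destruct (@ex_series_le C_AbsRing C_CompleteNormedModule a (fun n => Cmod (a n)))
    as [l Hl]; [| exact H |].
  - intros n; apply Rle_refl.
  - now rewrite (CSeries_unique a l Hl).
Qed.

Lemma CSeries_ext (a b : nat -> C) : (forall n, a n = b n) -> CSeries a = CSeries b.
Proof.
  intros H; unfold CSeries; f_equal; apply Series_ext; intros n; now rewrite H.
Qed.

(** [CSeries] sums real and imaginary parts separately; estimating each part by the moduli costs the
    factor 2, which is harmless in all uses. *)
Lemma Cmod_CSeries_le (a : nat -> C) :
  ex_series (fun n => Cmod (a n)) -> Cmod (CSeries a) <= 2 * Series (fun n => Cmod (a n)).
Proof.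
  intros H.
  assert (Hp : forall p : C -> R, (forall z, Rabs (p z) <= Cmod z) ->
     Rabs (Series (fun n => p (a n))) <= Series (fun n => Cmod (a n))).
  { intros p Hp.
    eapply Rle_trans; [apply Series_Rabs|].
    - apply (@ex_series_le R_AbsRing R_CompleteNormedModule) with (2 := H).
      intros n; change (Rabs (Rabs (p (a n))) <= Cmod (a n)); rewrite Rabs_Rabsolu; apply Hp.
    - apply Series_le; auto; intros n; split; [apply Rabs_pos | apply Hp]. }
  eapply Rle_trans; [apply Cmod_le_Re_Im|].
  generalize (Hp Re re_le_Cmod) (Hp Im im_le_Cmod); unfold CSeries; simpl; lra.
Qed.

Lemma CSeries_scal (c : C) (a : nat -> C) :
  ex_series (fun n => Cmod (a n)) -> CSeries (fun n => c * a n)%C = (c * CSeries a)%C.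
Proof.
  intros H; apply CSeries_unique.
  now apply (is_series_scal c a (CSeries a)), is_series_CSeries.
Qed.

Lemma CSeries_minus (a b : nat -> C) :
  ex_series (fun n => Cmod (a n)) -> ex_series (fun n => Cmod (b n)) ->
  CSeries (fun n => a n - b n)%C = (CSeries a - CSeries b)%C.
Proof.
  intros Ha Hb; apply CSeries_unique.
  apply (is_series_minus a b (CSeries a) (CSeries b)); now apply is_series_CSeries.
Qed.

(** * The complex exponential and its Taylor remainders *)

Lemma Cexp_plus (z w : C) : Cexp (z + w)%C = (Cexp z * Cexp w)%C.
Proof.
  destruct z as [x y], w as [u v]; unfold Cexp, Cplus, Cmult; simpl.
  rewrite exp_plus, cos_plus, sin_plus; f_equal; ring.
Qed.

Lemma Cexp_0 : Cexp 0%C = 1%C.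
Proof.
  unfold Cexp, RtoC; simpl; rewrite exp_0, cos_0, sin_0; f_equal; ring.
Qed.

Lemma Cmod_Cexp (z : C) : Cmod (Cexp z) = exp (Re z).
Proof.
  unfold Cexp, Cmod; cbn [fst snd].
  transitivity (sqrt (Rsqr (exp (Re z)) * (Rsqr (sin (Im z)) + Rsqr (cos (Im z))))).
  - f_equal; unfold Rsqr; ring.
  - rewrite sin2_cos2, Rmult_1_r; apply sqrt_Rsqr, Rlt_le, exp_pos.
Qed.

Lemma Cexp_neq_0 (z : C) : Cexp z <> 0%C.
Proof.
  apply Cmod_gt_0; rewrite Cmod_Cexp; apply exp_pos.
Qed.

Lemma Cexp_opp (z : C) : Cexp (- z)%C = (/ Cexp z)%C.
Proof.
  assert (H := Cexp_plus z (- z)%C).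
  rewrite Cplus_opp_r, Cexp_0 in H.
  generalize (Cexp_neq_0 z); intros Hz.
  replace (Cexp (- z)%C) with ((Cexp z * Cexp (- z)) / Cexp z)%C by now field.
  rewrite <- H; now field.
Qed.

Lemma Cexp_pow (z : C) (k : nat) : (Cexp z ^ k)%C = Cexp (RtoC (INR k) * z)%C.
Proof.
  induction k as [|k IH].
  - simpl; now rewrite Cmult_0_l, Cexp_0.
  - rewrite Cpow_S, IH, <- Cexp_plus, S_INR, RtoC_plus; f_equal; ring.
Qed.

Lemma Cmod_Cexp_le (z : C) : Cmod (Cexp z) <= exp (Cmod z).
Proof.
  rewrite Cmod_Cexp.
  destruct (Rle_lt_or_eq_dec (Re z) (Cmod z)) as [H|H].
  - generalize (re_le_Cmod z) (Rle_abs (Re z)); lra.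
  - now apply Rlt_le, exp_increasing.
  - rewrite H; apply Rle_refl.
Qed.

Lemma exp_le (x y : R) : x <= y -> exp x <= exp y.
Proof.
  intros [H|H]; [now apply Rlt_le, exp_increasing | rewrite H; apply Rle_refl].
Qed.

(** The mean value theorem fails for complex values; it is applied to the two parts, at different
    intermediate points, hence the factor 2. *)
Lemma C_mean_value (f f' : R -> C) (M : R) :
  (forall t, 0 <= t <= 1 -> is_derive (fun s => Re (f s)) t (Re (f' t))) ->
  (forall t, 0 <= t <= 1 -> is_derive (fun s => Im (f s)) t (Im (f' t))) ->
  (forall t, 0 <= t <= 1 -> Cmod (f' t) <= M) ->
  Cmod (f 1 - f 0)%C <= 2 * M.
Proof.
  intros Hre Him HM.
  eapply Rle_trans; [apply Cmod_le_Re_Im|].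
  assert (H : forall p : C -> R, (forall z, Rabs (p z) <= Cmod z) ->
     (forall t, 0 <= t <= 1 -> is_derive (fun s => p (f s)) t (p (f' t))) ->
     Rabs (p (f 1) - p (f 0)) <= M).
  { intros p Hp Hd.
    destruct (MVT_cor2 (fun s => p (f s)) (fun s => p (f' s)) 0 1) as [c [Hc1 Hc2]].
    - lra.
    - intros c Hc; now apply is_derive_Reals, Hd.
    - rewrite Hc1, Rminus_0_r, Rmult_1_r.
      eapply Rle_trans; [apply Hp | apply HM; lra]. }
  generalize (H Re re_le_Cmod Hre) (H Im im_le_Cmod Him).
  change (Re (f 1 - f 0)%C) with (Re (f 1) - Re (f 0)).
  change (Im (f 1 - f 0)%C) with (Im (f 1) - Im (f 0)).
  lra.
Qed.

Lemma Cmod_Cexp_minus_1 (z : C) : Cmod (Cexp z - 1)%C <= 2 * (Cmod z * exp (Cmod z)).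
Proof.
  replace (Cexp z - 1)%C with (Cexp (RtoC 1 * z) - Cexp (RtoC 0 * z))%C
    by now rewrite Cmult_1_l, Cmult_0_l, Cexp_0.
  apply (C_mean_value (fun t => Cexp (RtoC t * z)%C) (fun t => z * Cexp (RtoC t * z))%C).
  - intros t _; destruct z as [x y]; unfold Cexp, Cmult, RtoC; simpl;
      auto_derive; [easy | unfold Rminus; ring].
  - intros t _; destruct z as [x y]; unfold Cexp, Cmult, RtoC; simpl;
      auto_derive; [easy | unfold Rminus; ring].
  - intros t Ht; rewrite Cmod_mult.
    apply Rmult_le_compat_l; [apply Cmod_ge_0|].
    eapply Rle_trans; [apply Cmod_Cexp_le|].
    apply exp_le; rewrite Cmod_mult, Cmod_R, Rabs_pos_eq by lra.
    generalize (Cmod_ge_0 z); nra.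
Qed.

(** The derivative of [exp (t z) - t z] in [t] is [z (exp (t z) - 1)], to which the first-order
    estimate applies; each of the two mean value steps contributes a factor 2. *)
Lemma Cexp_taylor (z : C) : Cmod (Cexp z - 1 - z)%C <= 4 * (Cmod z ^ 2 * exp (Cmod z)).
Proof.
  replace (Cexp z - 1 - z)%C
    with ((Cexp (RtoC 1 * z) - RtoC 1 * z) - (Cexp (RtoC 0 * z) - RtoC 0 * z))%C
    by (rewrite Cmult_1_l, Cmult_0_l, Cexp_0; ring).
  replace (4 * (Cmod z ^ 2 * exp (Cmod z)))
    with (2 * (Cmod z * (2 * (Cmod z * exp (Cmod z))))) by ring.
  apply (C_mean_value (fun t => Cexp (RtoC t * z) - RtoC t * z)%C
           (fun t => z * (Cexp (RtoC t * z) - 1))%C).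
  - intros t _; destruct z as [x y]; unfold Cexp, Cmult, Cminus, Cplus, Copp, RtoC; simpl;
      auto_derive; [easy | unfold Rminus; ring].
  - intros t _; destruct z as [x y]; unfold Cexp, Cmult, Cminus, Cplus, Copp, RtoC; simpl;
      auto_derive; [easy | unfold Rminus; ring].
  - intros t Ht; rewrite Cmod_mult.
    apply Rmult_le_compat_l; [apply Cmod_ge_0|].
    eapply Rle_trans; [apply Cmod_Cexp_minus_1|].
    assert (H : Cmod (RtoC t * z)%C <= Cmod z).
    { rewrite Cmod_mult, Cmod_R, Rabs_pos_eq by lra; generalize (Cmod_ge_0 z); nra. }
    apply Rmult_le_compat_l; [lra|].
    apply Rmult_le_compat; auto using Cmod_ge_0, exp_le, Rlt_le, exp_pos.
Qed.

(** * The Gamma function in the right half-plane *)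

Lemma ln_le_minus_1 (x : R) : 0 < x -> ln x <= x - 1.
Proof.
  intros Hx.
  destruct (Req_dec (ln x) 0) as [H|H].
  - assert (x = 1) by (rewrite <- (exp_ln x Hx), H; apply exp_0). lra.
  - generalize (exp_ineq1 (ln x) H); rewrite exp_ln by easy; lra.
Qed.

(** Both bounds are [ln x <= x - 1], taken at [n / (n + 1)] and at [(n + 1) / n]. *)
Lemma ln_S_minus_ln (n : nat) :
  (1 <= n)%nat -> / (INR n + 1) <= ln (INR (S n)) - ln (INR n) <= / INR n.
Proof.
  intros Hn; assert (H0 : 0 < INR n) by (apply lt_0_INR; lia).
  rewrite S_INR; split.
  - assert (H := ln_le_minus_1 (INR n / (INR n + 1))).
    rewrite ln_div in H by lra.
    assert (INR n / (INR n + 1) = 1 - / (INR n + 1)) by (field; lra).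
    assert (0 < INR n / (INR n + 1)) by (apply Rdiv_lt_0_compat; lra).
    lra.
  - assert (H := ln_le_minus_1 ((INR n + 1) / INR n)).
    rewrite ln_div in H by lra.
    assert ((INR n + 1) / INR n = 1 + / INR n) by (field; lra).
    assert (0 < (INR n + 1) / INR n) by (apply Rdiv_lt_0_compat; lra).
    lra.
Qed.

(* Convexity of [exp]: the tangent at [ln (1 + x u) / x] lies below the graph. *)
Lemma bernoulli_exp (x u : R) : 1 <= x -> 0 <= u -> 1 + x * u <= exp (x * ln (1 + u)).
Proof.
  intros Hx Hu.
  assert (Hp : 0 < 1 + x * u) by nra.
  set (b := ln (1 + x * u)); set (t := / x).
  assert (Ht : 0 < t <= 1).
  { unfold t; split; [apply Rinv_0_lt_compat; lra|].
    rewrite <- Rinv_1; apply Rinv_le_contravar; lra. }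
  assert (Htx : t * x = 1) by (unfold t; field; lra).
  assert (Hb : exp b = 1 + x * u) by (unfold b; now apply exp_ln).
  assert (H1 := exp_ineq1_le (b - t * b)).
  assert (H2 := exp_ineq1_le (- (t * b))).
  assert (Hpos := exp_pos (t * b)).
  assert (E1 : exp b = exp (t * b) * exp (b - t * b)) by (rewrite <- exp_plus; f_equal; ring).
  assert (E2 : 1 = exp (t * b) * exp (- (t * b)))
    by (rewrite <- exp_plus, <- exp_0; f_equal; ring).
  (* The tangent at [t * b], read at [b] and at [0] with weights [t] and [1 - t], gives
     [exp (t * b) <= t * exp b + (1 - t)]. *)
  assert (H3 : exp (t * b) <= 1 + u).
  { assert (exp (t * b) * (1 + (b - t * b)) <= exp b)
      by (rewrite E1; apply Rmult_le_compat_l; lra).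
    assert (exp (t * b) * (1 + - (t * b)) <= 1)
      by (rewrite E2 at 2; apply Rmult_le_compat_l; lra).
    assert (t * exp b + (1 - t) = 1 + u).
    { rewrite Hb; replace (t * (1 + x * u) + (1 - t)) with (1 + t * x * u) by ring.
      rewrite Htx; ring. }
    nra. }
  rewrite <- Hb; apply exp_le.
  assert (H4 : t * b <= ln (1 + u)).
  { rewrite <- (ln_exp (t * b)); apply ln_le; [apply exp_pos | exact H3]. }
  replace b with (x * (t * b)) by (rewrite <- Rmult_assoc, (Rmult_comm x), Htx; ring).
  apply Rmult_le_compat_l; lra.
Qed.

Definition gauss (w : C) (n : nat) : C :=
  (RtoC (INR (fact n)) * Cexp (w * RtoC (ln (INR n))) / Cpochhammer w (S n))%C.

Lemma Cmod_plus_INR_ge (w : C) (n : nat) : 0 < Re w -> INR n < Cmod (w + RtoC (INR n))%C.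
Proof.
  intros H.
  apply Rlt_le_trans with (2 := re_le_Cmod _).
  apply Rlt_le_trans with (2 := Rle_abs _).
  change (INR n < Re w + INR n); lra.
Qed.

Lemma plus_INR_neq_0 (w : C) (n : nat) : 0 < Re w -> (w + RtoC (INR n))%C <> 0%C.
Proof.
  intros H; apply Cmod_gt_0.
  generalize (Cmod_plus_INR_ge w n H) (pos_INR n); lra.
Qed.

Lemma Cpochhammer_neq_0 (w : C) (n : nat) : 0 < Re w -> Cpochhammer w n <> 0%C.
Proof.
  intros H; induction n as [|n IH]; simpl.
  - apply C1_nz.
  - apply Cmult_neq_0; [exact IH | now apply plus_INR_neq_0].
Qed.

Lemma Cpochhammer_shift (w : C) (n : nat) :
  (w * Cpochhammer (w + 1) n)%C = Cpochhammer w (S n).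
Proof.
  induction n as [|n IH].
  - simpl; ring.
  - change (Cpochhammer (w + 1) (S n))
      with (Cpochhammer (w + 1) n * (w + 1 + RtoC (INR n)))%C.
    change (Cpochhammer w (S (S n))) with (Cpochhammer w (S n) * (w + RtoC (INR (S n))))%C.
    rewrite <- IH, S_INR, RtoC_plus; ring.
Qed.

Lemma gauss_S (w : C) (n : nat) : 0 < Re w ->
  gauss w (S n) =
    (gauss w n * (Cexp (w * RtoC (ln (INR (S n)) - ln (INR n))) * RtoC (INR (S n))
       / (w + RtoC (INR (S n)))))%C.
Proof.
  intros H; unfold gauss.
  change (Cpochhammer w (S (S n))) with (Cpochhammer w (S n) * (w + RtoC (INR (S n))))%C.
  replace (w * RtoC (ln (INR (S n))))%C
    with (w * RtoC (ln (INR n)) + w * RtoC (ln (INR (S n)) - ln (INR n)))%C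
    by (rewrite RtoC_minus; ring).
  rewrite Cexp_plus.
  replace (INR (fact (S n))) with (INR (S n) * INR (fact n))
    by now rewrite <- mult_INR.
  rewrite RtoC_mult.
  generalize (Cpochhammer_neq_0 w (S n) H) (plus_INR_neq_0 w (S n) H).
  generalize (Cpochhammer w (S n)); intros p Hp Hq; field; now split.
Qed.

(** With [h = ln ((n+1)/n)] and [m = n + 1], the quotient of consecutive Gauss terms minus 1 has
    numerator [m (exp (w h) - 1 - w h) + w (m h - 1)]. Both summands are [O(1/n)], and the
    denominator exceeds [m] in modulus. The resulting [O(1/n^2)] is written as a difference so that
    it telescopes. *)
Lemma gauss_step (w : C) : 0 < Re w -> exists K : R, 0 <= K /\
  forall n, (1 <= n)%nat ->
    Cmod (Cexp (w * RtoC (ln (INR (S n)) - ln (INR n))) * RtoC (INR (S n))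
       / (w + RtoC (INR (S n))) - 1)%C <= K * (/ INR n - / INR (S n)).
Proof.
  intros H.
  (* The Taylor remainder gives [4 |w|^2 exp |w|], the term [w (m h - 1)] gives [|w|], and the outer
     2 comes from [1/n^2 <= 2 (1/n - 1/(n+1))]. *)
  exists (2 * (4 * (Cmod w ^ 2 * exp (Cmod w)) + Cmod w)); split.
  { generalize (Cmod_ge_0 w) (exp_pos (Cmod w)); intros; simpl; nra. }
  intros n Hn.
  set (h := ln (INR (S n)) - ln (INR n)); set (m := INR (S n)).
  assert (Hh := ln_S_minus_ln n Hn); fold h in Hh.
  assert (Hn1 : 1 <= INR n) by (apply (le_INR 1); lia).
  assert (Hm : m = INR n + 1) by (unfold m; apply S_INR).
  rewrite <- Hm in Hh.
  assert (Hq : m < Cmod (w + RtoC m)%C) by now apply Cmod_plus_INR_ge.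
  assert (Hq0 : (w + RtoC m)%C <> 0%C) by (apply Cmod_gt_0; lra).
  replace (Cexp (w * RtoC h) * RtoC m / (w + RtoC m) - 1)%C
    with ((RtoC m * (Cexp (w * RtoC h) - 1 - w * RtoC h) + w * RtoC (m * h - 1))
           / (w + RtoC m))%C
    by (rewrite RtoC_minus, RtoC_mult; field; easy).
  rewrite Cmod_div by easy.
  apply Rle_div_l; [lra|].
  eapply Rle_trans; [apply Cmod_triangle|].
  rewrite !Cmod_mult, !Cmod_R.
  assert (T := Cexp_taylor (w * RtoC h)%C).
  rewrite Cmod_mult, Cmod_R in T.
  assert (Hinv : 0 < / INR n <= 1).
  { split; [apply Rinv_0_lt_compat; lra|].
    rewrite <- Rinv_1; apply Rinv_le_contravar; lra. }
  assert (Hinvm : 0 < / m) by (apply Rinv_0_lt_compat; lra).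
  rewrite (Rabs_pos_eq h) in T by lra.
  rewrite (Rabs_pos_eq m) by lra.
  assert (Hmh : 0 <= m * h - 1 <= / INR n).
  { assert (m * / m = 1) by (field; lra).
    assert (m * / INR n = 1 + / INR n) by (rewrite Hm; field; lra).
    nra. }
  rewrite (Rabs_pos_eq (m * h - 1)) by lra.
  set (a := Cmod w) in *; assert (Ha : 0 <= a) by apply Cmod_ge_0.
  assert (E1 : exp (a * h) <= exp a) by (apply exp_le; nra).
  assert (E2 : (a * h) ^ 2 * exp (a * h) <= a ^ 2 * exp a * (/ INR n) ^ 2).
  { replace (a ^ 2 * exp a * (/ INR n) ^ 2) with ((a * / INR n) ^ 2 * exp a) by ring.
    apply Rmult_le_compat; [apply pow2_ge_0 | apply Rlt_le, exp_pos | | exact E1].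
    apply pow_incr; nra. }
  assert (E3 : / INR n - / m = / INR n * / m) by (rewrite Hm; field; lra).
  assert (E4 : 1 <= 2 * (INR n * / m)).
  { assert (INR n * / m = 1 - / m) by (rewrite Hm; field; lra).
    assert (m * / m = 1) by (field; lra). nra. }
  assert (E5 : (/ INR n) ^ 2 <= 2 * (/ INR n - / m)).
  { rewrite E3; replace ((/ INR n) ^ 2) with (/ INR n * / INR n) by ring.
    assert (/ INR n <= 2 * / m).
    { replace (2 * / m) with (/ INR n * (2 * (INR n * / m))) by (field; lra). nra. }
    nra. }
  set (e := / INR n) in *.
  assert (Hea := exp_pos a).
  set (S4 := 4 * (a ^ 2 * exp a)).
  assert (HS4 : 0 <= S4) by (unfold S4; simpl; nra).
  assert (F1 : m * Cmod (Cexp (w * RtoC h) - 1 - w * RtoC h)%C <= m * (S4 * e ^ 2)).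
  { apply Rmult_le_compat_l; [lra|]. unfold S4; nra. }
  assert (F2 : a * (m * h - 1) <= m * (a * e ^ 2)).
  { apply Rle_trans with (a * e); [nra|].
    assert (m * e = 1 + e) by (unfold e; rewrite Hm; field; lra).
    replace (m * (a * e ^ 2)) with (a * e * (m * e)) by ring.
    assert (0 <= a * e) by nra. nra. }
  apply Rle_trans with (m * ((S4 + a) * (2 * (e - / m)))).
  - apply Rle_trans with (m * ((S4 + a) * e ^ 2)); [lra|].
    apply Rmult_le_compat_l; [lra|]. apply Rmult_le_compat_l; lra.
  - replace (2 * (S4 + a) * (e - / m)) with ((S4 + a) * (2 * (e - / m))) by ring.
    assert (0 <= (S4 + a) * (2 * (e - / m))).
    { generalize (pow2_ge_0 e); intros; apply Rmult_le_pos; lra. }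
    nra.
Qed.

Lemma is_lim_seq_inv_INR : is_lim_seq (fun n => / INR (S n)) 0.
Proof.
  apply (is_lim_seq_incr_1 (fun n => / INR n)).
  change (Finite 0) with (Rbar_inv p_infty).
  apply is_lim_seq_inv; [apply is_lim_seq_INR | easy].
Qed.

Lemma is_series_telescope :
  is_series (fun n => / INR (S n) - / INR (S (S n))) 1.
Proof.
  apply (is_lim_seq_ext (fun n => 1 - / INR (S (S n)))
    (sum_n (fun n => / INR (S n) - / INR (S (S n)))) 1).
  - intros n; symmetry; induction n as [|n IH].
    + rewrite sum_O; simpl; field.
    + rewrite sum_Sn, IH; change plus with Rplus; simpl plus; cbn [plus]; ring.
  - replace 1 with (1 - 0) at 1 by ring.
    apply (is_lim_seq_minus' _ _ 1 0); [apply is_lim_seq_const|].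
    apply (is_lim_seq_incr_1 (fun n => / INR (S n))), is_lim_seq_inv_INR.
Qed.

(* Bounded total variation: the factors [1 + O (1/n^2)] keep [u] bounded, so that
   its increments are dominated by a telescoping series. *)
Lemma ex_limit_of_quotients (u : nat -> C) (K : R) : 0 <= K ->
  (forall n, Cmod (u (S n) - u n)%C <= Cmod (u n) * (K * (/ INR (S n) - / INR (S (S n))))) ->
  exists l : C, filterlim u eventually (locally l).
Proof.
  intros HK Hu.
  (* A discrete Gronwall argument: [1 + d <= exp d] turns the product of the factors into the
     exponential of a telescoping sum, which stays below [K]. *)
  assert (Hb : forall n, Cmod (u n) <= Cmod (u 0%nat) * exp (K * (1 - / INR (S n)))).
  { induction n as [|n IH].
    - simpl; rewrite Rinv_1, Rminus_diag, Rmult_0_r, exp_0; lra.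
    - set (d := K * (/ INR (S n) - / INR (S (S n)))).
      replace (K * (1 - / INR (S (S n)))) with (K * (1 - / INR (S n)) + d) by (unfold d; ring).
      rewrite exp_plus.
      replace (u (S n)) with (u n + (u (S n) - u n))%C by ring.
      eapply Rle_trans; [apply Cmod_triangle|].
      assert (H1 := Hu n); fold d in H1.
      assert (H2 := exp_ineq1_le d).
      assert (Hd : 0 <= d).
      { unfold d; apply Rmult_le_pos; [exact HK|].
        assert (/ INR (S (S n)) <= / INR (S n)); [|lra].
        apply Rinv_le_contravar; [apply lt_0_INR; lia | apply le_INR; lia]. }
      rewrite <- Rmult_assoc.
      generalize (Cmod_ge_0 (u n)); nra. }
  set (B := Cmod (u 0%nat) * exp K).
  assert (HB : forall n, Cmod (u n) <= B).
  { intros n; eapply Rle_trans; [apply Hb|].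
    apply Rmult_le_compat_l; [apply Cmod_ge_0|].
    apply exp_le.
    assert (0 < / INR (S n)) by (apply Rinv_0_lt_compat, lt_0_INR; lia). nra. }
  destruct (@ex_series_le C_AbsRing C_CompleteNormedModule
     (fun n => u (S n) - u n)%C
     (fun n => (B * K) * (/ INR (S n) - / INR (S (S n))))) as [l Hl].
  - intros n; eapply Rle_trans; [apply Hu|].
    rewrite Rmult_assoc; apply Rmult_le_compat_r; [|apply HB].
    apply Rmult_le_pos; [exact HK|].
    assert (/ INR (S (S n)) <= / INR (S n)); [|lra].
    apply Rinv_le_contravar; [apply lt_0_INR; lia | apply le_INR; lia].
  - apply (ex_series_scal_l (B * K) (fun n => / INR (S n) - / INR (S (S n)))).
    eexists; apply is_series_telescope.
  - exists (l + u 0%nat)%C.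
    apply filterlim_Cmod; [apply eventually_filter|].
    intros eps.
    destruct (proj1 (filterlim_Cmod _ _ _) Hl eps) as [N HN].
    (* The increments up to index [n] add up to [u (S n) - u 0], so the threshold shifts by one. *)
    exists (S N); intros [|n] Hn; [lia|].
    replace (u (S n) - (l + u 0%nat))%C with (sum_n (fun n => u (S n) - u n)%C n - l)%C.
    + apply HN; lia.
    + replace (@sum_n C_AbelianMonoid (fun n => u (S n) - u n)%C n) with (u (S n) - u 0%nat)%C;
        [ring|].
      clear; induction n as [|n IH].
      * now rewrite sum_O.
      * rewrite sum_Sn, <- IH; change plus with Cplus; cbn [plus]; ring.
Qed.

(** [Lim_seq] is total, so [CGamma w] carries information only once the Gauss sequence is known to
    converge; all later facts on Gamma enter through this lemma. *)
Lemma CGamma_gauss (w : C) : 0 < Re w -> filterlim (gauss w) eventually (locally (CGamma w)).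
Proof.
  intros H.
  (* The term of index 0 involves the default value of [ln 0]; the quotient estimate starts at index
     1, and dropping one term does not change the limit. *)
  assert (E : exists l : C, filterlim (fun n => gauss w (S n)) eventually (locally l)).
  { destruct (gauss_step w H) as [K [HK Hs]].
    apply ex_limit_of_quotients with K; [exact HK|].
    intros n.
    replace (gauss w (S (S n)) - gauss w (S n))%C
      with (gauss w (S n) * (Cexp (w * RtoC (ln (INR (S (S n))) - ln (INR (S n))))
         * RtoC (INR (S (S n))) / (w + RtoC (INR (S (S n)))) - 1))%C.
    - rewrite Cmod_mult; apply Rmult_le_compat_l; [apply Cmod_ge_0|].
      apply Hs; lia.
    - rewrite (gauss_S w (S n) H); ring. }
  destruct E as [l Hl].
  assert (Hl' : filterlim (gauss w) eventually (locally l)).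
  { apply filterlim_C_iff in Hl; [|apply eventually_filter].
    apply filterlim_C_iff; [apply eventually_filter|].
    destruct Hl as [H1 H2]; split.
    - now apply (is_lim_seq_incr_1 (fun n => Re (gauss w n)) (Re l)).
    - now apply (is_lim_seq_incr_1 (fun n => Im (gauss w n)) (Im l)). }
  replace (CGamma w) with l; [exact Hl'|].
  apply filterlim_C_iff in Hl'; [|apply eventually_filter].
  destruct Hl' as [H1 H2].
  change (CGamma w) with (real (Lim_seq (fun n => Re (gauss w n))),
                          real (Lim_seq (fun n => Im (gauss w n)))).
  rewrite (is_lim_seq_unique _ (Finite (Re l)) H1), (is_lim_seq_unique _ (Finite (Im l)) H2).
  now destruct l.
Qed.

Lemma gauss_plus_1 (w : C) (n : nat) : 0 < Re w -> (1 <= n)%nat ->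
  gauss (w + 1)%C n = (w * gauss w n * (RtoC (INR n) / (w + RtoC (INR (S n)))))%C.
Proof.
  intros H Hn; unfold gauss.
  assert (Hw : w <> 0%C).
  { intros ->; simpl in H; lra. }
  assert (Hp := Cpochhammer_shift w (S n)).
  change (Cpochhammer w (S (S n))) with (Cpochhammer w (S n) * (w + RtoC (INR (S n))))%C in Hp.
  assert (H1 := Cpochhammer_neq_0 w (S n) H); assert (H2 := plus_INR_neq_0 w (S n) H).
  replace (Cpochhammer (w + 1) (S n))
    with (Cpochhammer w (S n) * (w + RtoC (INR (S n))) / w)%C by (rewrite <- Hp; field; easy).
  replace (Cexp ((w + 1) * RtoC (ln (INR n))))%C
    with (Cexp (w * RtoC (ln (INR n))) * RtoC (INR n))%C.
  - revert H1 H2; generalize (Cpochhammer w (S n)); intros p H1 H2; field; now repeat split.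
  - replace ((w + 1) * RtoC (ln (INR n)))%C with (w * RtoC (ln (INR n)) + RtoC (ln (INR n)))%C
      by ring.
    rewrite Cexp_plus; f_equal.
    unfold Cexp, RtoC; simpl.
    rewrite exp_ln by (apply lt_0_INR; lia).
    rewrite cos_0, sin_0; f_equal; ring.
Qed.

Lemma CGamma_plus_1 (w : C) : 0 < Re w -> CGamma (w + 1)%C = (w * CGamma w)%C.
Proof.
  intros H.
  assert (H1 : 0 < Re (w + 1)%C) by (change (0 < Re w + 1); lra).
  apply (filterlim_locally_unique (F := eventually) (V := C_NormedModule)
     (gauss (w + 1)%C)); [now apply CGamma_gauss|].
  assert (L : filterlim (fun n => RtoC (INR n) / (w + RtoC (INR (S n))))%C
                eventually (locally (RtoC 1))).
  { apply filterlim_Cmod; [apply eventually_filter|]; intros eps.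
    destruct (proj1 (filterlim_locally _ 0) is_lim_seq_inv_INR
      (mkposreal _ (Rdiv_lt_0_compat _ _ (cond_pos eps)
         (Rle_lt_0_plus_1 _ (Cmod_ge_0 (w + 1)%C))))) as [N HN].
    exists N; intros n Hn; specialize (HN n Hn).
    change (Rabs (/ INR (S n) - 0) < eps / (Cmod (w + 1) + 1)) in HN.
    rewrite Rminus_0_r in HN.
    assert (Hm : 0 < INR (S n)) by (apply lt_0_INR; lia).
    assert (Hq := Cmod_plus_INR_ge w (S n) H).
    assert (H2 := plus_INR_neq_0 w (S n) H).
    replace (RtoC (INR n) / (w + RtoC (INR (S n))) - 1)%C
      with (- (w + 1) / (w + RtoC (INR (S n))))%C.
    - rewrite Cmod_div, Cmod_opp by easy.
      assert (HN2 := Rinv_0_lt_compat _ Hm).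
      rewrite Rabs_pos_eq in HN by lra.
      apply Rlt_div_r in HN; [|generalize (Cmod_ge_0 (w + 1)%C); lra].
      apply Rle_lt_trans with (Cmod (w + 1)%C * / INR (S n)); [|lra].
      apply Rmult_le_compat_l; [apply Cmod_ge_0|].
      apply Rinv_le_contravar; lra.
    - revert H2; rewrite S_INR, RtoC_plus; intros H2; field; exact H2. }
  replace (w * CGamma w)%C with (w * CGamma w * 1)%C by ring.
  apply (filterlim_ext_loc (fun n => w * gauss w n * (RtoC (INR n) / (w + RtoC (INR (S n)))))%C).
  - exists 1%nat; intros n Hn; symmetry; now apply gauss_plus_1.
  - apply filterlim_Cmult; [apply eventually_filter | | exact L].
    apply filterlim_Cmult; [apply eventually_filter | apply filterlim_const |].
    now apply CGamma_gauss.
Qed.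

(** * A lower bound for Gamma on cones *)

Lemma Cmod_Cpochhammer_S (w : C) (n : nat) :
  Cmod (Cpochhammer w (S n)) = Cmod (Cpochhammer w n) * Cmod (w + RtoC (INR n))%C.
Proof. apply Cmod_mult. Qed.

Lemma Cmod_plus_INR_real (x : R) (n : nat) : 0 < x ->
  Cmod (RtoC x + RtoC (INR n))%C = x + INR n.
Proof.
  intros Hx; rewrite <- RtoC_plus, Cmod_R, Rabs_pos_eq; [easy|].
  generalize (pos_INR n); lra.
Qed.

(** With [r = Re w + n] and [y = Im w], the exact modulus is [r * sqrt (1 + y^2/r^2)]. Dropping the
    root only worsens a constant in the exponent, and the exponential turns the product over [n]
    into a sum. *)
Lemma Cmod_plus_INR_le (w : C) (n : nat) : 0 < Re w ->
  Cmod (w + RtoC (INR n))%C <= (Re w + INR n) * exp (Im w ^ 2 * / (Re w + INR n) ^ 2).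
Proof.
  intros H; set (r := Re w + INR n).
  assert (Hr : 0 < r) by (unfold r; generalize (pos_INR n); lra).
  apply Rle_trans with (r * (1 + Im w ^ 2 * / r ^ 2)).
  2: apply Rmult_le_compat_l; [lra | apply exp_ineq1_le].
  assert (Hs : 0 <= Im w ^ 2 * / r ^ 2).
  { apply Rmult_le_pos; [apply pow2_ge_0 | apply Rlt_le, Rinv_0_lt_compat, pow_lt, Hr]. }
  apply Rsqr_incr_0_var; [|nra].
  rewrite !Rsqr_pow2, Cmod2_alt.
  change (Re (w + RtoC (INR n))%C) with r.
  replace (Im (w + RtoC (INR n))%C) with (Im w) by (symmetry; apply Rplus_0_r).
  assert (E : r ^ 2 * (Im w ^ 2 * / r ^ 2) = Im w ^ 2) by (field; lra).
  replace ((r * (1 + Im w ^ 2 * / r ^ 2)) ^ 2)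
    with (r ^ 2 + 2 * (r ^ 2 * (Im w ^ 2 * / r ^ 2)) + (r * (Im w ^ 2 * / r ^ 2)) ^ 2) by ring.
  rewrite E; generalize (pow2_ge_0 (r * (Im w ^ 2 * / r ^ 2))) (pow2_ge_0 (Im w)); lra.
Qed.

(* [prod_k (1 + y^2/(x+k)^2)^(1/2)] is controlled by the telescoping bound
   [1/(x+k)^2 <= 1/(x+k-1) - 1/(x+k)]. *)
Lemma Cpochhammer_le_real (w : C) (n : nat) : 0 < Re w ->
  Cmod (Cpochhammer w (S n)) <=
    Cmod (Cpochhammer (RtoC (Re w)) (S n)) *
      exp (Im w ^ 2 * (/ Re w ^ 2 + / Re w - / (Re w + INR n))).
Proof.
  intros H; induction n as [|n IH].
  - rewrite !Cmod_Cpochhammer_S, Cmod_plus_INR_real by easy.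
    simpl Cpochhammer; rewrite Cmod_1, !Rmult_1_l.
    (* The factor at [k = 0] has nothing to telescope with; it accounts for the separate term
       [/ Re w ^ 2]. *)
    replace (/ Re w ^ 2 + / Re w - / (Re w + INR 0)) with (/ (Re w + INR 0) ^ 2)
      by (simpl; field; lra).
    now apply Cmod_plus_INR_le.
  - rewrite (Cmod_Cpochhammer_S w), (Cmod_Cpochhammer_S (RtoC (Re w))), Cmod_plus_INR_real by easy.
    set (x := Re w) in *; set (y := Im w) in *.
    set (r := x + INR n) in *; assert (Hr : 0 < r) by (unfold r; generalize (pos_INR n); lra).
    assert (Hr1 : x + INR (S n) = r + 1) by (rewrite S_INR; unfold r; ring).
    assert (Hw := Cmod_plus_INR_le w (S n) H); fold x y in Hw; rewrite Hr1 in *.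
    apply Rle_trans with (1 := Rmult_le_compat _ _ _ _ (Cmod_ge_0 _) (Cmod_ge_0 _) IH Hw).
    replace (_ * _ * _) with (Cmod (Cpochhammer (RtoC x) (S n)) * (r + 1) *
      exp (y ^ 2 * (/ x ^ 2 + / x - / r) + y ^ 2 * / (r + 1) ^ 2))
      by (rewrite exp_plus; ring).
    apply Rmult_le_compat_l.
    { apply Rmult_le_pos; [apply Cmod_ge_0 | lra]. }
    apply exp_le; rewrite <- Rmult_plus_distr_l.
    apply Rmult_le_compat_l; [apply pow2_ge_0|].
    assert (/ (r + 1) ^ 2 <= / (r * (r + 1))).
    { apply Rinv_le_contravar; nra. }
    assert (/ (r * (r + 1)) = / r - / (r + 1)) by (field; lra).
    lra.
Qed.

(** With [m = n + 1], the quotient of consecutive terms is [m (1 + 1/m)^x / (x + m)], and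
    Bernoulli's inequality for the real exponent [x >= 1] makes it at least 1. *)
Lemma gauss_real_incr (x : R) (n : nat) : 1 <= x ->
  INR (fact n) * exp (x * ln (INR (S n))) / Cmod (Cpochhammer (RtoC x) (S n)) <=
  INR (fact (S n)) * exp (x * ln (INR (S (S n)))) / Cmod (Cpochhammer (RtoC x) (S (S n))).
Proof.
  intros Hx.
  rewrite (Cmod_Cpochhammer_S _ (S n)), Cmod_plus_INR_real by lra.
  assert (Hp : 0 < Cmod (Cpochhammer (RtoC x) (S n))).
  { apply Cmod_gt_0, Cpochhammer_neq_0; simpl; lra. }
  set (p := Cmod (Cpochhammer (RtoC x) (S n))) in *.
  replace (INR (fact (S n))) with (INR (S n) * INR (fact n)) by now rewrite <- mult_INR.
  set (m := INR (S n)).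
  assert (Hm : 0 < m) by (apply lt_0_INR; lia).
  replace (ln (INR (S (S n)))) with (ln m + ln (1 + / m)).
  2: { assert (0 < / m) by now apply Rinv_0_lt_compat.
       rewrite <- ln_mult by lra; f_equal; rewrite (S_INR (S n)); fold m; field; lra. }
  rewrite Rmult_plus_distr_l, exp_plus.
  assert (B := bernoulli_exp x (/ m) Hx (Rlt_le _ _ (Rinv_0_lt_compat _ Hm))).
  apply Rle_div_l; [lra|].
  set (E := exp (x * ln (1 + / m))) in *.
  replace (m * INR (fact n) * (exp (x * ln m) * E) / (p * (x + m)) * p)
    with (INR (fact n) * exp (x * ln m) * (m * E / (x + m))) by (field; lra).
  rewrite <- (Rmult_1_r (INR (fact n) * exp (x * ln m))) at 1.
  apply Rmult_le_compat_l.
  { apply Rmult_le_pos; [apply pos_INR | apply Rlt_le, exp_pos]. }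
  apply Rle_div_r; [lra|].
  assert (m * (1 + x * / m) = m + x) by (field; lra).
  nra.
Qed.

(** Each factor obeys [x + j <= (p + j) (1 + x/p) <= (p + j) exp (x/p)]. A product of [p] factors is
    therefore [O(exp x)], at the same rate for every [p]; this is the case used, with [j = p]. *)
Lemma Cpochhammer_real_le (p j : nat) : (1 <= p)%nat -> exists K : R, 0 < K /\
  forall x, 0 < x -> Cmod (Cpochhammer (RtoC x) j) <= K * exp (INR j * (x / INR p)).
Proof.
  intros Hp; assert (Hp0 : 0 < INR p) by (apply lt_0_INR; lia).
  induction j as [|j [K [HK IH]]].
  - exists 1; split; [lra|]; intros x _.
    simpl; rewrite Cmod_1, Rmult_0_l, exp_0; lra.
  - exists (K * (INR p + INR j)); assert (Hj := pos_INR j); split; [nra|].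
    intros x Hx; rewrite Cmod_Cpochhammer_S, Cmod_plus_INR_real by easy.
    rewrite S_INR, Rmult_plus_distr_r, exp_plus, Rmult_1_l.
    assert (Ht : 0 < x / INR p) by now apply Rdiv_lt_0_compat.
    assert (x + INR j <= (INR p + INR j) * exp (x / INR p)).
    { assert (H := exp_ineq1_le (x / INR p)).
      assert (x = INR p * (x / INR p)) by (field; lra). nra. }
    replace (K * (INR p + INR j) * (exp (INR j * (x / INR p)) * exp (x / INR p)))
      with (K * exp (INR j * (x / INR p)) * ((INR p + INR j) * exp (x / INR p))) by ring.
    apply Rmult_le_compat; [apply Cmod_ge_0 | lra | now apply IH | easy].
Qed.

(** Two losses make up [1 + 2 c^2]: replacing [n^x] by [(n+1)^x] costs at most [exp x], since
    [ln (n+1) - ln n <= 1]; replacing [w] by its real part in the Pochhammer product costs at most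
    [exp (2 y^2 / x)], which is at most [exp (2 c^2 x)] on the cone. *)
Lemma Cmod_gauss_ge (w : C) (c : R) (n : nat) :
  1 <= Re w -> Rabs (Im w) <= c * Re w -> (1 <= n)%nat ->
  INR (fact n) * exp (Re w * ln (INR (S n))) / Cmod (Cpochhammer (RtoC (Re w)) (S n)) *
    exp (- (1 + 2 * c ^ 2) * Re w) <= Cmod (gauss w n).
Proof.
  intros Hx Hy Hn; unfold gauss.
  rewrite Cmod_div, Cmod_mult, Cmod_R, Cmod_Cexp by (apply Cpochhammer_neq_0; lra).
  rewrite (Rabs_pos_eq (INR _)) by apply pos_INR.
  rewrite re_scal_r.
  assert (Hp : 0 < Cmod (Cpochhammer w (S n))) by (apply Cmod_gt_0, Cpochhammer_neq_0; lra).
  assert (Hq : 0 < Cmod (Cpochhammer (RtoC (Re w)) (S n))).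
  { apply Cmod_gt_0, Cpochhammer_neq_0; simpl; lra. }
  assert (H := Cpochhammer_le_real w n (Rlt_le_trans _ _ _ Rlt_0_1 Hx)).
  set (x := Re w) in *; set (y := Im w) in *.
  set (T := y ^ 2 * (/ x ^ 2 + / x - / (x + INR n))) in *.
  assert (HT : T <= 2 * c ^ 2 * x).
  { assert (Hx0 : 0 < / x) by (apply Rinv_0_lt_compat; lra).
    assert (Hx1 : / x <= 1) by (rewrite <- Rinv_1; apply Rinv_le_contravar; lra).
    assert (0 < / (x + INR n)) by (apply Rinv_0_lt_compat; generalize (pos_INR n); lra).
    assert (Hi : / x ^ 2 + / x - / (x + INR n) <= 2 * / x).
    { replace (/ x ^ 2) with (/ x * / x) by (field; lra); nra. }
    assert (Hy2 : y ^ 2 <= (c * x) ^ 2).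
    { rewrite <- (pow2_abs y); apply pow_incr; split; [apply Rabs_pos | easy]. }
    apply Rle_trans with (y ^ 2 * (2 * / x)).
    - apply Rmult_le_compat_l; [apply pow2_ge_0 | easy].
    - replace (2 * c ^ 2 * x) with ((c * x) ^ 2 * (2 * / x)) by (field; lra).
      apply Rmult_le_compat_r; lra. }
  assert (Hl : x * ln (INR (S n)) - x <= x * ln (INR n)).
  { assert (L := ln_S_minus_ln n Hn).
    assert (1 <= INR n) by (apply (le_INR 1); lia).
    assert (/ INR n <= 1) by (rewrite <- Rinv_1; apply Rinv_le_contravar; lra).
    nra. }
  set (q := Cmod (Cpochhammer (RtoC x) (S n))) in *.
  set (p := Cmod (Cpochhammer w (S n))) in *.
  apply (proj1 (Rle_div_r _ _ _ Hp)).
  assert (HF := pos_INR (fact n)).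
  apply Rle_trans with (INR (fact n) * exp (x * ln (INR (S n))) / q *
     exp (- (1 + 2 * c ^ 2) * x) * (q * exp T)).
  - apply Rmult_le_compat_l; [|exact H].
    apply Rmult_le_pos; [|apply Rlt_le, exp_pos].
    apply Rdiv_le_0_compat; [|easy].
    apply Rmult_le_pos; [easy | apply Rlt_le, exp_pos].
  - replace (INR (fact n) * exp (x * ln (INR (S n))) / q *
     exp (- (1 + 2 * c ^ 2) * x) * (q * exp T))
      with (INR (fact n) * exp (x * ln (INR (S n)) + - (1 + 2 * c ^ 2) * x + T))
      by (rewrite !exp_plus; field; lra).
    apply Rmult_le_compat_l; [easy|].
    apply exp_le; lra.
Qed.

(* [A] is arbitrary: it is this superexponential growth that makes the Prabhakar series entire. *)
Lemma Cmod_CGamma_ge (c A : R) : exists K : R, 0 < K /\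
  forall w : C, 1 <= Re w -> Rabs (Im w) <= c * Re w -> K * exp (A * Re w) <= Cmod (CGamma w).
Proof.
  (* The index [m] is chosen with [ln (m+1) >= A + 2 + 2 c^2]: the target rate [A], the loss
     [1 + 2 c^2] from the complex comparison, and 1 for the factor [exp x] bounding the Pochhammer
     product. *)
  destruct (nfloor_ex (exp (Rabs (A + 2 + 2 * c ^ 2)))) as [m [_ Hm]];
    [apply Rlt_le, exp_pos|].
  rewrite <- S_INR in Hm.
  assert (HS : 0 < INR (S m)) by (apply lt_0_INR; lia).
  assert (HA : A + 2 + 2 * c ^ 2 <= ln (INR (S m))).
  { rewrite <- (ln_exp (A + 2 + 2 * c ^ 2)).
    apply ln_le; [apply exp_pos|].
    apply Rle_trans with (2 := Rlt_le _ _ Hm), exp_le, Rle_abs. }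
  destruct (Cpochhammer_real_le (S m) (S m)) as [K [HK Hpoch]]; [lia|].
  assert (Hf : 0 < INR (fact m)) by apply INR_fact_lt_0.
  exists (INR (fact m) / K); split; [now apply Rdiv_lt_0_compat|].
  intros w Hx Hy.
  assert (Hlim := CGamma_gauss w (Rlt_le_trans _ _ _ Rlt_0_1 Hx)).
  apply (filterlim_comp _ _ _ _ Cmod _ _ (locally (Cmod (CGamma w)))) in Hlim;
    [|exact (filterlim_norm (V := C_NormedModule) (CGamma w))].
  change (is_lim_seq (fun n => Cmod (gauss w n)) (Cmod (CGamma w))) in Hlim.
  apply (is_lim_seq_le_loc (fun _ => INR (fact m) / K * exp (A * Re w)) (fun n => Cmod (gauss w n))
    (Finite _) (Finite _)); [| apply is_lim_seq_const | exact Hlim].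
  exists (S m); intros n Hn.
  eapply Rle_trans; [|apply (Cmod_gauss_ge w c n Hx Hy); lia].
  set (x := Re w) in *.
  set (g := fun n => INR (fact n) * exp (x * ln (INR (S n))) / Cmod (Cpochhammer (RtoC x) (S n))).
  change (INR (fact m) / K * exp (A * x) <= g n * exp (- (1 + 2 * c ^ 2) * x)).
  (* Monotonicity in the index makes the single term [m] a lower bound for all later ones, hence for
     the limit. *)
  assert (Hg : g m <= g n).
  { assert (Hmn : (m <= n)%nat) by lia.
    induction Hmn as [|n' Hmn IH]; [apply Rle_refl|].
    destruct (Nat.eq_dec m n') as [<-|Hne]; [now apply gauss_real_incr|].
    apply Rle_trans with (g n'); [apply IH; lia | now apply gauss_real_incr]. }
  apply Rle_trans with (g m * exp (- (1 + 2 * c ^ 2) * x)).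
  2: apply Rmult_le_compat_r; [apply Rlt_le, exp_pos | exact Hg].
  assert (Hp := Hpoch x (Rlt_le_trans _ _ _ Rlt_0_1 Hx)).
  replace (INR (S m) * (x / INR (S m))) with x in Hp by (field; lra).
  assert (Hq : 0 < Cmod (Cpochhammer (RtoC x) (S m))).
  { apply Cmod_gt_0, Cpochhammer_neq_0; simpl; lra. }
  unfold g.
  apply Rle_trans with (INR (fact m) * exp (x * ln (INR (S m))) / (K * exp x)
    * exp (- (1 + 2 * c ^ 2) * x)).
  - replace (INR (fact m) * exp (x * ln (INR (S m))) / (K * exp x) * exp (- (1 + 2 * c ^ 2) * x))
      with (INR (fact m) / K * exp (x * ln (INR (S m)) + - x + - (1 + 2 * c ^ 2) * x)).
    + apply Rmult_le_compat_l; [now apply Rlt_le, Rdiv_lt_0_compat|].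
      apply exp_le; nra.
    + rewrite !exp_plus, exp_Ropp; field; split; [|lra].
      generalize (exp_pos x); lra.
  - apply Rmult_le_compat_r; [apply Rlt_le, exp_pos|].
    apply Rmult_le_compat_l.
    + apply Rmult_le_pos; [lra | apply Rlt_le, exp_pos].
    + now apply Rinv_le_contravar.
Qed.

Lemma ex_series_pow_div_CGamma (sigma tau : C) (r : R) :
  0 < Re sigma -> 0 < Re tau -> 0 <= r ->
  ex_series (fun k => r ^ k / Cmod (CGamma (sigma * RtoC (INR k) + tau + 1)%C)).
Proof.
  intros Hs Ht Hr.
  (* The slope is such that [|Im sigma| k + |Im tau| <= c (Re sigma k + Re tau + 1)]; the second
     summand uses [Re w >= 1]. *)
  set (c := Rabs (Im sigma) / Re sigma + Rabs (Im tau)).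
  (* Then [exp (A * Re sigma) = 2 (r + 1)], so the quotient by Gamma is dominated by a geometric
     series of ratio [1/2]; [r + 1] keeps the logarithm meaningful at [r = 0]. *)
  set (A := (ln (2 * (r + 1))) / Re sigma).
  destruct (Cmod_CGamma_ge c A) as [K [HK HG]].
  set (K' := K * exp (A * (Re tau + 1))).
  assert (HK' : 0 < K') by (apply Rmult_lt_0_compat; [easy | apply exp_pos]).
  apply (@ex_series_le R_AbsRing R_CompleteNormedModule _ (fun k => / K' * (/ 2) ^ k)).
  2: { apply (ex_series_scal_l (/ K') (fun k => (/ 2) ^ k)), ex_series_geom.
       rewrite Rabs_pos_eq; lra. }
  intros k; change (norm ?x) with (Rabs x).
  set (w := (sigma * RtoC (INR k) + tau + 1)%C).
  assert (Hk := pos_INR k).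
  assert (HRe : Re w = Re sigma * INR k + Re tau + 1) by (unfold w, Re, Im; simpl; ring).
  assert (HIm : Im w = Im sigma * INR k + Im tau) by (unfold w, Re, Im; simpl; ring).
  assert (H1 : K * exp (A * Re w) <= Cmod (CGamma w)).
  { apply HG.
    - rewrite HRe; nra.
    - rewrite HIm, HRe; eapply Rle_trans; [apply Rabs_triang|].
      rewrite Rabs_mult, (Rabs_pos_eq (INR k)) by easy.
      assert (E : Rabs (Im sigma) = Rabs (Im sigma) / Re sigma * Re sigma) by (field; lra).
      unfold c.
      set (d := Rabs (Im sigma) / Re sigma) in *.
      assert (0 <= d) by (apply Rdiv_le_0_compat; [apply Rabs_pos | easy]).
      rewrite E; generalize (Rabs_pos (Im tau)); intros.
      assert (0 <= Re sigma * INR k) by nra.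
      nra. }
  replace (exp (A * Re w)) with (exp (A * (Re tau + 1)) * (2 * (r + 1)) ^ k) in H1.
  2: { rewrite HRe.
       replace (A * (Re sigma * INR k + Re tau + 1))
         with (A * (Re tau + 1) + INR k * ln (2 * (r + 1)))
         by (unfold A; field; lra).
       rewrite exp_plus; f_equal.
       rewrite <- Rpower_pow by lra; reflexivity. }
  rewrite <- Rmult_assoc in H1; fold K' in H1.
  assert (Hpow : 0 < (2 * (r + 1)) ^ k) by (apply pow_lt; lra).
  assert (H2 : 0 < K' * (2 * (r + 1)) ^ k) by now apply Rmult_lt_0_compat.
  rewrite Rabs_pos_eq.
  2: apply Rdiv_le_0_compat; [now apply pow_le | lra].
  apply Rle_trans with (r ^ k / (K' * (2 * (r + 1)) ^ k)).
  - apply Rmult_le_compat_l; [now apply pow_le | now apply Rinv_le_contravar].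
  - rewrite Rpow_mult_distr, pow_inv.
    assert (H3 : 0 < (r + 1) ^ k) by (apply pow_lt; lra).
    assert (H4 : 0 < 2 ^ k) by (apply pow_lt; lra).
    replace (r ^ k / (K' * (2 ^ k * (r + 1) ^ k)))
      with (/ K' * / 2 ^ k * (r ^ k / (r + 1) ^ k)) by (field; lra).
    rewrite <- (Rmult_1_r (/ K' * / 2 ^ k)) at 2.
    apply Rmult_le_compat_l.
    + apply Rmult_le_pos; apply Rlt_le, Rinv_0_lt_compat; easy.
    + apply Rle_div_l; [easy|]; rewrite Rmult_1_l; apply pow_incr; lra.
Qed.

(** * Exponential series and logarithms *)

Lemma ex_series_Cmod_le (a : nat -> C) (b : nat -> R) :
  (forall k, Cmod (a k) <= b k) -> ex_series b -> ex_series (fun k => Cmod (a k)).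
Proof.
  intros H; apply (@ex_series_le R_AbsRing R_CompleteNormedModule).
  intros k; change (norm ?x) with (Rabs x).
  rewrite Rabs_pos_eq; [apply H | apply Cmod_ge_0].
Qed.

(** A majorant of the terms [c k * Cexp (mu k * z)], uniform on the disc [Cmod z <= B]. Asking it
    for every [B] makes the condition stable under termwise differentiation. *)
Definition exp_summable (c mu : nat -> C) : Prop :=
  forall B, 0 <= B -> ex_series (fun k => Cmod (c k) * exp (Cmod (mu k) * B)).

(** A general Dirichlet series with complex exponents. *)
Definition exp_series (c mu : nat -> C) (z : C) : C :=
  CSeries (fun k => c k * Cexp (mu k * z))%C.

(** Since [|mu| <= exp |mu|], enlarging [B] by 1 pays for the extra factor. *)
Lemma exp_summable_mult (c mu : nat -> C) :
  exp_summable c mu -> exp_summable (fun k => c k * mu k)%C mu.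
Proof.
  intros H B HB.
  apply (@ex_series_le R_AbsRing R_CompleteNormedModule)
    with (b := fun k => Cmod (c k) * exp (Cmod (mu k) * (B + 1))).
  - intros k; change (norm ?x) with (Rabs x).
    rewrite Rabs_pos_eq
      by (apply Rmult_le_pos; [apply Cmod_ge_0 | apply Rlt_le, exp_pos]).
    rewrite Cmod_mult, Rmult_assoc.
    apply Rmult_le_compat_l; [apply Cmod_ge_0|].
    rewrite Rmult_plus_distr_l, exp_plus, Rmult_1_r, Rmult_comm.
    apply Rmult_le_compat_l; [apply Rlt_le, exp_pos|].
    generalize (exp_ineq1_le (Cmod (mu k))); lra.
  - apply H; lra.
Qed.

Lemma exp_summable_ex_series (c mu : nat -> C) (z : C) : exp_summable c mu ->
  ex_series (fun k => Cmod (c k * Cexp (mu k * z))%C).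
Proof.
  intros H; apply ex_series_Cmod_le with (2 := H (Cmod z) (Cmod_ge_0 z)).
  intros k; rewrite Cmod_mult; apply Rmult_le_compat_l; [apply Cmod_ge_0|].
  eapply Rle_trans; [apply Cmod_Cexp_le|]; rewrite Cmod_mult; apply Rle_refl.
Qed.

(** Stronger than complex differentiability with derivative [D]: an explicit quadratic remainder on
    the unit disc can be summed term by term, and it yields both continuity and the chain rule along
    a real parameter. *)
Definition quadratic_at (F : C -> C) (z D : C) : Prop :=
  exists K : R, 0 <= K /\ forall d, Cmod d <= 1 ->
    Cmod (F (z + d) - F z - D * d)%C <= K * Cmod d ^ 2.

Lemma Cexp_quadratic (z : C) : quadratic_at Cexp z (Cexp z).
Proof.
  exists (Cmod (Cexp z) * (4 * exp 1)); split.
  { generalize (Cmod_ge_0 (Cexp z)) (exp_pos 1); nra. }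
  intros d Hd; rewrite Cexp_plus.
  replace (Cexp z * Cexp d - Cexp z - Cexp z * d)%C with (Cexp z * (Cexp d - 1 - d))%C by ring.
  rewrite Cmod_mult, Rmult_assoc; apply Rmult_le_compat_l; [apply Cmod_ge_0|].
  eapply Rle_trans; [apply Cexp_taylor|].
  rewrite Rmult_assoc, (Rmult_comm (Cmod d ^ 2)).
  apply Rmult_le_compat_l; [lra|].
  apply Rmult_le_compat_r; [apply pow2_ge_0 | now apply exp_le].
Qed.

(** The [k]-th remainder is [c_k exp (mu_k z) (exp (mu_k d) - 1 - mu_k d)]. As [|d| <= 1], it is at
    most [4 |d|^2] times [|c_k mu_k^2| exp (|mu_k| (|z| + 1))], a summable sequence because
    [exp_summable] survives two multiplications by [mu]. *)
Lemma exp_series_quadratic (c mu : nat -> C) (z : C) : exp_summable c mu ->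
  quadratic_at (exp_series c mu) z (exp_series (fun k => c k * mu k)%C mu z).
Proof.
  intros H.
  assert (H1 := exp_summable_mult c mu H).
  set (B := Cmod z + 1).
  assert (HB : 0 <= B) by (unfold B; generalize (Cmod_ge_0 z); lra).
  set (b := fun k => Cmod (c k * mu k * mu k)%C * exp (Cmod (mu k) * B)).
  assert (Hb : ex_series b) by exact (exp_summable_mult _ mu H1 B HB).
  assert (Hb0 : forall k, 0 <= b k).
  { intros k; apply Rmult_le_pos; [apply Cmod_ge_0 | apply Rlt_le, exp_pos]. }
  exists (2 * (4 * Series b)); split.
  { assert (0 <= Series b); [|lra].
    eapply Rle_trans; [apply Rabs_pos|]; eapply Rle_trans; [apply Series_Rabs|].
    - apply ex_series_ext with (2 := Hb); intros k; now rewrite Rabs_pos_eq.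
    - apply Series_le; [intros k; rewrite Rabs_pos_eq; auto using Rle_refl | exact Hb]. }
  intros d Hd.
  assert (Hterm : forall k, Cmod (c k * Cexp (mu k * (z + d)) - c k * Cexp (mu k * z)
             - d * (c k * mu k * Cexp (mu k * z)))%C <= 4 * Cmod d ^ 2 * b k).
  { intros k; unfold b.
    replace (mu k * (z + d))%C with (mu k * z + mu k * d)%C by ring.
    rewrite Cexp_plus.
    replace (c k * (Cexp (mu k * z) * Cexp (mu k * d)) - c k * Cexp (mu k * z)
             - d * (c k * mu k * Cexp (mu k * z)))%C
      with (c k * Cexp (mu k * z) * (Cexp (mu k * d) - 1 - mu k * d))%C by ring.
    rewrite !Cmod_mult.
    assert (T := Cexp_taylor (mu k * d)%C); rewrite Cmod_mult in T.
    assert (E := Cmod_Cexp_le (mu k * z)%C); rewrite Cmod_mult in E.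
    replace (Cmod (mu k) * B) with (Cmod (mu k) * Cmod z + Cmod (mu k)) by (unfold B; ring).
    rewrite exp_plus.
    assert (Hm := Cmod_ge_0 (mu k)).
    assert (E2 : exp (Cmod (mu k) * Cmod d) <= exp (Cmod (mu k))).
    { apply exp_le; nra. }
    replace (4 * Cmod d ^ 2 * (Cmod (c k) * Cmod (mu k) * Cmod (mu k) *
       (exp (Cmod (mu k) * Cmod z) * exp (Cmod (mu k)))))
      with (Cmod (c k) * exp (Cmod (mu k) * Cmod z) *
         (4 * ((Cmod (mu k) * Cmod d) ^ 2 * exp (Cmod (mu k))))) by ring.
    apply Rmult_le_compat; [apply Rmult_le_pos; apply Cmod_ge_0 | apply Cmod_ge_0 | |].
    - apply Rmult_le_compat_l; [apply Cmod_ge_0 | exact E].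
    - eapply Rle_trans; [exact T|].
      apply Rmult_le_compat_l; [lra|].
      apply Rmult_le_compat_l; [apply pow2_ge_0 | exact E2]. }
  assert (S1 := exp_summable_ex_series c mu (z + d)%C H).
  assert (S2 := exp_summable_ex_series c mu z H).
  assert (S3 := exp_summable_ex_series _ mu z H1).
  unfold exp_series.
  rewrite (Cmult_comm _ d), <- CSeries_scal, <- !CSeries_minus; try assumption.
  - eapply Rle_trans; [apply Cmod_CSeries_le|].
    + apply ex_series_Cmod_le with (1 := Hterm).
      now apply (ex_series_scal_l (4 * Cmod d ^ 2) b).
    + replace (2 * (4 * Series b) * Cmod d ^ 2) with (2 * (4 * Cmod d ^ 2 * Series b)) by ring.
      apply Rmult_le_compat_l; [lra|].
      rewrite <- Series_scal_l.
      apply Series_le; [|now apply (ex_series_scal_l (4 * Cmod d ^ 2) b)].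
      intros k; split; [apply Cmod_ge_0 | apply Hterm].
  - apply ex_series_Cmod_le with (b := fun k => Cmod (c k * Cexp (mu k * (z + d)))%C
       + Cmod (c k * Cexp (mu k * z))%C).
    + intros k; unfold Cminus; eapply Rle_trans; [apply Cmod_triangle|].
      rewrite Cmod_opp; apply Rle_refl.
    + now apply (ex_series_plus (V := R_NormedModule)).
  - apply ex_series_ext with (fun k => Cmod d * Cmod (c k * mu k * Cexp (mu k * z))%C).
    + intros k; now rewrite <- Cmod_mult.
    + now apply (ex_series_scal_l (Cmod d) (fun k => Cmod (c k * mu k * Cexp (mu k * z))%C)).
Qed.

Lemma quadratic_at_filterlim {T : Type} (FF : (T -> Prop) -> Prop) {HFF : Filter FF}
    (F : C -> C) (z D : C) (f : T -> C) :
  quadratic_at F z D -> filterlim f FF (locally z) ->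
  filterlim (fun t => F (f t)) FF (locally (F z)).
Proof.
  intros [K [HK H]] Hf.
  apply filterlim_Cmod; [exact HFF|]; intros eps.
  assert (HM : 0 < K + Cmod D + 1) by (generalize (Cmod_ge_0 D); lra).
  set (e := Rmin 1 (eps / (K + Cmod D + 1))).
  assert (He : 0 < e).
  { apply Rmin_pos; [lra | apply Rdiv_lt_0_compat; [apply cond_pos | easy]]. }
  generalize (proj1 (filterlim_Cmod _ _ _) Hf (mkposreal e He)); simpl.
  apply filter_imp; intros t Ht.
  set (d := (f t - z)%C) in *.
  replace (f t) with (z + d)%C by (unfold d; ring).
  assert (Hd1 : Cmod d < 1) by (apply Rlt_le_trans with (1 := Ht), Rmin_l).
  assert (Hd2 : Cmod d < eps / (K + Cmod D + 1)) by (apply Rlt_le_trans with (1 := Ht), Rmin_r).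
  apply (proj2 (Rlt_div_r _ _ _ HM)) in Hd2.
  replace (F (z + d) - F z)%C with ((F (z + d) - F z - D * d) + D * d)%C by ring.
  eapply Rle_lt_trans; [apply Cmod_triangle|]; rewrite Cmod_mult.
  assert (H1 := H d (Rlt_le _ _ Hd1)).
  generalize (Cmod_ge_0 d) (Cmod_ge_0 D); intros.
  assert (Cmod d ^ 2 <= Cmod d) by nra.
  assert (K * Cmod d ^ 2 <= K * Cmod d) by (apply Rmult_le_compat_l; lra).
  nra.
Qed.

(** * Derivatives along a real parameter: chain rule and branches of the logarithm *)

Lemma norm_C_R (z : C) : @norm R_AbsRing C_R_NormedModule z = Cmod z.
Proof.
  change (sqrt (Rabs (fst z) ^ 2 + Rabs (snd z) ^ 2) = Cmod z).
  now rewrite !pow2_abs.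
Qed.

Lemma is_derive_Cmod (f : R -> C) (s : R) (l : C) :
  @is_derive R_AbsRing C_R_NormedModule f s l <->
  forall eps : posreal, locally s (fun t =>
    Cmod (f t - f s - RtoC (t - s) * l)%C <= eps * Rabs (t - s)).
Proof.
  assert (E : forall t, minus (minus (f t) (f s)) (@scal R_AbsRing C_R_NormedModule (minus t s) l)
      = (f t - f s - RtoC (t - s) * l)%C).
  { intros t; change (minus t s) with (t - s); rewrite <- scal_R_Cmult; reflexivity. }
  split.
  - intros [_ H] eps.
    assert (H0 := H s (fun P HP => HP) eps).
    revert H0; apply filter_imp; intros t Ht.
    rewrite <- (E t), <- norm_C_R; exact Ht.
  - intros H; split.
    + apply (is_linear_scal_l (V := C_R_NormedModule) l).
    + intros x Hx eps.
      apply (is_filter_lim_locally_unique (V := R_NormedModule)) in Hx.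
      subst x.
      generalize (H eps); apply filter_imp; intros t Ht.
      rewrite <- (E t), <- norm_C_R in Ht; exact Ht.
Qed.

Lemma is_derive_quadratic_comp (F : C -> C) (D : C) (l : R -> C) (s : R) (l' : C) :
  quadratic_at F (l s) D ->
  @is_derive R_AbsRing C_R_NormedModule l s l' ->
  @is_derive R_AbsRing C_R_NormedModule (fun t => F (l t)) s (D * l')%C.
Proof.
  intros [K [HK H]] Hl.
  assert (Hl1 := proj1 (is_derive_Cmod _ _ _) Hl).
  apply is_derive_Cmod; intros eps.
  assert (HD := Cmod_ge_0 D); assert (Hl' := Cmod_ge_0 l').
  (* [L] is a local Lipschitz constant of [l] at [s]. The bound [|h| < / L] puts the increment in
     the unit disc; the other thresholds give half of [eps] to the quadratic remainder and half to
     the error of [l] itself. *)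
  set (L := Cmod l' + 1).
  assert (He1 : 0 < Rmin 1 (eps / (2 * (Cmod D + 1)))).
  { apply Rmin_pos; [lra | apply Rdiv_lt_0_compat; [apply cond_pos | lra]]. }
  set (e1 := mkposreal _ He1).
  assert (HL : 1 <= L) by (unfold L; lra).
  assert (He2 : 0 < Rmin (/ L) (eps / (2 * (K * L ^ 2 + 1)))).
  { apply Rmin_pos; [apply Rinv_0_lt_compat; lra | apply Rdiv_lt_0_compat; [apply cond_pos|]].
    generalize (pow2_ge_0 L); nra. }
  assert (Hloc : locally s (fun t => Rabs (t - s) < Rmin (/ L) (eps / (2 * (K * L ^ 2 + 1))))).
  { exists (mkposreal _ He2); intros t Ht; exact Ht. }
  generalize (filter_and _ _ (Hl1 e1) Hloc); apply filter_imp.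
  intros t [H1 H2]; cbn [pos e1] in H1.
  set (h := t - s) in *; set (d := (l t - l s)%C) in *.
  replace (l t) with (l s + d)%C by (unfold d; ring).
  assert (H3 : Rabs h < / L) by (apply Rlt_le_trans with (1 := H2), Rmin_l).
  assert (H4 : Rabs h < eps / (2 * (K * L ^ 2 + 1))) by (apply Rlt_le_trans with (1 := H2), Rmin_r).
  assert (Hh := Rabs_pos h).
  assert (E1 : Cmod (d - RtoC h * l')%C <= 1 * Rabs h).
  { eapply Rle_trans; [exact H1|]; apply Rmult_le_compat_r; [easy | apply Rmin_l]. }
  assert (E2 : Cmod (d - RtoC h * l')%C <= eps / (2 * (Cmod D + 1)) * Rabs h).
  { eapply Rle_trans; [exact H1|]; apply Rmult_le_compat_r; [easy | apply Rmin_r]. }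
  assert (Hd : Cmod d <= L * Rabs h).
  { replace d with ((d - RtoC h * l') + RtoC h * l')%C by ring.
    eapply Rle_trans; [apply Cmod_triangle|]; rewrite Cmod_mult, Cmod_R; unfold L; lra. }
  assert (Hd1 : Cmod d <= 1).
  { apply Rle_trans with (1 := Hd).
    apply Rle_trans with (L * / L); [apply Rmult_le_compat_l; lra|].
    rewrite Rinv_r; lra. }
  replace (F (l s + d) - F (l s) - RtoC h * (D * l'))%C
    with ((F (l s + d) - F (l s) - D * d) + D * (d - RtoC h * l'))%C by ring.
  eapply Rle_trans; [apply Cmod_triangle|]; rewrite Cmod_mult.
  assert (F1 : K * Cmod d ^ 2 <= eps / 2 * Rabs h).
  { assert (HKL : 0 <= K * L ^ 2) by (generalize (pow2_ge_0 L); nra).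
    apply Rle_trans with (K * (L * Rabs h) ^ 2).
    - apply Rmult_le_compat_l; [easy|]; apply pow_incr; split; [apply Cmod_ge_0 | easy].
    - replace (K * (L * Rabs h) ^ 2) with (K * L ^ 2 * Rabs h * Rabs h) by ring.
      apply Rmult_le_compat_r; [easy|].
      assert (HP : 0 < 2 * (K * L ^ 2 + 1)) by lra.
      apply (proj2 (Rlt_div_r _ _ _ HP)) in H4; nra. }
  assert (F2 : Cmod D * Cmod (d - RtoC h * l')%C <= eps / 2 * Rabs h).
  { apply Rle_trans with ((Cmod D + 1) * (eps / (2 * (Cmod D + 1)) * Rabs h)).
    - apply Rmult_le_compat; [easy | apply Cmod_ge_0 | lra | easy].
    - right; field; lra. }
  generalize (H d Hd1); lra.
Qed.

(** The derivative of a continuous local inverse. With [d] the increment of [l] and [q] that of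
    [Cexp (l t)], [E d = q + O(|d|^2)]; continuity makes [d] small enough to absorb the quadratic
    term, so [d = O(h)], and then that term is [o(h)]. *)
Lemma is_derive_log (l : R -> C) (s : R) (v : C) :
  filterlim l (locally s) (locally (l s)) ->
  @is_derive R_AbsRing C_R_NormedModule (fun t => Cexp (l t)) s v ->
  @is_derive R_AbsRing C_R_NormedModule l s (v / Cexp (l s))%C.
Proof.
  intros Hc Hv.
  destruct (Cexp_quadratic (l s)) as [K [HK H]].
  set (E := Cexp (l s)) in *.
  assert (HE : E <> 0%C) by apply Cexp_neq_0.
  assert (HE0 : 0 < Cmod E) by now apply Cmod_gt_0.
  apply is_derive_Cmod; intros eps.
  set (V := Cmod v + 1).
  assert (HV : 1 <= V) by (unfold V; generalize (Cmod_ge_0 v); lra).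
  assert (He1 : 0 < Rmin 1 (eps * Cmod E / 2)).
  { apply Rmin_pos; [lra|]; generalize (cond_pos eps); nra. }
  (* The three thresholds for [|d|] serve, in order, the validity of the quadratic estimate, the
     absorption in [B4] and the final smallness in [B5]. *)
  assert (He2 : 0 < Rmin 1 (Rmin (Cmod E / (2 * (K + 1)))
                     (eps * (Cmod E) ^ 2 / (4 * V * (K + 1))))).
  { assert (He := cond_pos eps).
    repeat apply Rmin_pos; [lra | |]; apply Rdiv_lt_0_compat; try nra.
    apply Rmult_lt_0_compat; [easy | now apply pow_lt]. }
  generalize (filter_and _ _ (proj1 (is_derive_Cmod _ _ _) Hv (mkposreal _ He1))
     (proj1 (filterlim_Cmod _ _ _) Hc (mkposreal _ He2))).
  apply filter_imp; intros t [H1 H2]; cbn [pos] in H1, H2; fold E in H1.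
  set (h := t - s) in *; set (d := (l t - l s)%C) in *.
  replace (Cexp (l t)) with (Cexp (l s + d)) in H1 by (f_equal; unfold d; ring).
  assert (Hd0 := Cmod_ge_0 d); assert (Hh := Rabs_pos h).
  assert (A1 : Cmod d <= 1) by (apply Rlt_le, Rlt_le_trans with (1 := H2), Rmin_l).
  assert (A2 : Cmod d < Cmod E / (2 * (K + 1))).
  { apply Rlt_le_trans with (1 := H2); eapply Rle_trans; [apply Rmin_r | apply Rmin_l]. }
  assert (A3 : Cmod d < eps * (Cmod E) ^ 2 / (4 * V * (K + 1))).
  { apply Rlt_le_trans with (1 := H2); eapply Rle_trans; [apply Rmin_r | apply Rmin_r]. }
  assert (P2 : 0 < 2 * (K + 1)) by lra.
  assert (P3 : 0 < 4 * V * (K + 1)) by nra.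
  apply (proj2 (Rlt_div_r _ _ _ P2)) in A2.
  apply (proj2 (Rlt_div_r _ _ _ P3)) in A3.
  assert (Q := H d A1); fold E in Q.
  set (q := (Cexp (l s + d) - E)%C) in *.
  assert (B1 : Cmod (q - RtoC h * v)%C <= 1 * Rabs h).
  { eapply Rle_trans; [exact H1|]; apply Rmult_le_compat_r; [easy | apply Rmin_l]. }
  assert (B2 : Cmod (q - RtoC h * v)%C <= eps * Cmod E / 2 * Rabs h).
  { eapply Rle_trans; [exact H1|]; apply Rmult_le_compat_r; [easy | apply Rmin_r]. }
  assert (B3 : Cmod q <= V * Rabs h).
  { replace q with ((q - RtoC h * v) + RtoC h * v)%C by ring.
    eapply Rle_trans; [apply Cmod_triangle|]; rewrite Cmod_mult, Cmod_R; unfold V; lra. }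
  (* Absorption: [K |d|^2] is at most half of [|E| |d|] and moves to the left side, which gives the
     factor 2. *)
  assert (B4 : Cmod E * Cmod d <= 2 * (V * Rabs h)).
  { assert (Cmod E * Cmod d <= Cmod q + K * Cmod d ^ 2).
    { rewrite <- Cmod_mult.
      replace (E * d)%C with (q + - (q - E * d))%C by ring.
      eapply Rle_trans; [apply Cmod_triangle|]; rewrite Cmod_opp; lra. }
    assert (K * Cmod d ^ 2 <= Cmod E / 2 * Cmod d).
    { replace (K * Cmod d ^ 2) with (K * Cmod d * Cmod d) by ring.
      apply Rmult_le_compat_r; nra. }
    lra. }
  replace (d - RtoC h * (v / E))%C with ((- (q - E * d) + (q - RtoC h * v)) / E)%C
    by (field; easy).
  rewrite Cmod_div by easy.
  apply Rle_div_l; [easy|].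
  eapply Rle_trans; [apply Cmod_triangle|]; rewrite Cmod_opp.
  assert (B5 : K * Cmod d ^ 2 <= eps * Cmod E / 2 * Rabs h).
  { apply Rmult_le_reg_r with (Cmod E); [easy|].
    replace (K * Cmod d ^ 2 * Cmod E) with (K * Cmod d * (Cmod E * Cmod d)) by ring.
    apply Rle_trans with (K * Cmod d * (2 * (V * Rabs h))).
    - apply Rmult_le_compat_l; [nra | easy].
    - replace (K * Cmod d * (2 * (V * Rabs h))) with (Cmod d * (4 * V * K) / 2 * Rabs h) by field.
      replace (eps * Cmod E / 2 * Rabs h * Cmod E)
        with (eps * Cmod E ^ 2 / 2 * Rabs h) by field.
      apply Rmult_le_compat_r; [easy|].
      assert (Cmod d * (4 * V * K) <= Cmod d * (4 * V * (K + 1))).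
      { apply Rmult_le_compat_l; [easy|]; nra. }
      lra. }
  lra.
Qed.

(** * The Prabhakar function along a path *)

Definition Cprabhakar (sigma tau delta x : C) : C :=
  CSeries (fun k => Cpochhammer delta k
    / (RtoC (INR (fact k)) * CGamma (sigma * RtoC (INR k) + tau)) * x ^ k)%C.

Lemma INR_fact_C_neq_0 (k : nat) : RtoC (INR (fact k)) <> 0%C.
Proof. intros H; apply RtoC_inj in H; now apply (INR_fact_neq_0 k). Qed.

(** From [|delta + k| <= (k + 1) (|delta| + 1)]: the quotient [(delta)_k / k!] grows at most
    geometrically, so it only rescales the radius [r] in the series with Gamma. *)
Lemma Cmod_Cpochhammer_le (delta : C) (k : nat) :
  Cmod (Cpochhammer delta k) <= INR (fact k) * (Cmod delta + 1) ^ k.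
Proof.
  induction k as [|k IH]; [simpl; rewrite Cmod_1; lra|].
  rewrite Cmod_Cpochhammer_S.
  replace (INR (fact (S k)) * (Cmod delta + 1) ^ S k)
    with (INR (fact k) * (Cmod delta + 1) ^ k * (INR (S k) * (Cmod delta + 1)))
    by (change (fact (S k)) with (S k * fact k)%nat; rewrite mult_INR; simpl pow; ring).
  apply Rmult_le_compat; try apply Cmod_ge_0; [exact IH|].
  eapply Rle_trans; [apply Cmod_triangle|].
  rewrite Cmod_R, Rabs_pos_eq, S_INR by apply pos_INR.
  generalize (pos_INR k) (Cmod_ge_0 delta); nra.
Qed.

(** A single [w] with [1 <= Re w] lies in the cone of slope [|Im w|], and the rate [A = 0] already
    gives a positive lower bound. *)
Lemma CGamma_neq_0 (w : C) : 1 <= Re w -> CGamma w <> 0%C.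
Proof.
  intros H.
  destruct (Cmod_CGamma_ge (Rabs (Im w)) 0) as [K [HK HG]].
  apply Cmod_gt_0, Rlt_le_trans with (2 := HG w H ltac:(generalize (Rabs_pos (Im w)); nra)).
  rewrite Rmult_0_l, exp_0; lra.
Qed.

Section Prabhakar.

Variables sigma tau delta lambda : C.
Hypothesis Hsigma : 0 < Re sigma.
Hypothesis Htau : 0 < Re tau.

(** The bracketing [tau + 1] matches the terms of [Cprabhakar sigma (tau + 1)] literally; regrouped,
    the argument of Gamma is [mu_k + 1]. *)
Definition prabhakar_coef (k : nat) : C :=
  (Cpochhammer delta k
    / (RtoC (INR (fact k)) * CGamma (sigma * RtoC (INR k) + (tau + 1))))%C.

Definition prabhakar_exponent (k : nat) : C := (sigma * RtoC (INR k) + tau)%C.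

Definition prabhakar_exp_coef (k : nat) : C := (prabhakar_coef k * lambda ^ k)%C.

Lemma Re_prabhakar_exponent_pos (k : nat) : 0 < Re (prabhakar_exponent k).
Proof.
  replace (Re (prabhakar_exponent k)) with (Re sigma * INR k + Re tau)
    by (unfold prabhakar_exponent, Re; simpl; ring).
  generalize (pos_INR k); nra.
Qed.

Lemma CGamma_prabhakar_exponent_neq_0 (k : nat) : CGamma (prabhakar_exponent k + 1)%C <> 0%C.
Proof.
  apply CGamma_neq_0.
  generalize (Re_prabhakar_exponent_pos k).
  change (Re (prabhakar_exponent k + 1)%C) with (Re (prabhakar_exponent k) + 1); lra.
Qed.

Lemma prabhakar_coef_alt (k : nat) :
  prabhakar_coef k = (Cpochhammer delta k
    / (RtoC (INR (fact k)) * CGamma (prabhakar_exponent k + 1)))%C.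
Proof. unfold prabhakar_coef, prabhakar_exponent; now rewrite Cplus_assoc. Qed.

Lemma ex_series_prabhakar_coef (r : R) :
  0 <= r -> ex_series (fun k => Cmod (prabhakar_coef k) * r ^ k).
Proof.
  intros Hr.
  apply (@ex_series_le R_AbsRing R_CompleteNormedModule)
    with (2 := ex_series_pow_div_CGamma sigma tau ((Cmod delta + 1) * r) Hsigma Htau
                 ltac:(generalize (Cmod_ge_0 delta); nra)).
  intros k; change (norm ?x) with (Rabs x).
  rewrite Rabs_pos_eq by (apply Rmult_le_pos; [apply Cmod_ge_0 | now apply pow_le]).
  rewrite prabhakar_coef_alt.
  fold (prabhakar_exponent k).
  assert (HG := CGamma_prabhakar_exponent_neq_0 k); assert (HG0 := proj1 (Cmod_gt_0 _) HG).
  assert (HF := INR_fact_C_neq_0 k).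
  rewrite Cmod_div, Cmod_mult, Cmod_R, Rabs_pos_eq
    by (try apply pos_INR; now apply Cmult_neq_0).
  assert (HF0 := INR_fact_lt_0 k).
  rewrite Rpow_mult_distr.
  unfold Rdiv; rewrite Rinv_mult, <- !Rmult_assoc, (Rmult_comm _ (r ^ k)), (Rmult_comm _ (r ^ k)),
    !Rmult_assoc.
  apply Rmult_le_compat_l; [now apply pow_le|].
  rewrite <- !Rmult_assoc; apply Rmult_le_compat_r; [now apply Rlt_le, Rinv_0_lt_compat|].
  apply Rle_div_l; [easy|]; rewrite Rmult_comm; apply Cmod_Cpochhammer_le.
Qed.

Lemma Cprabhakar_bounded (r : R) : 0 <= r ->
  exists B, 0 <= B /\ forall x, Cmod x <= r -> Cmod (Cprabhakar sigma (tau + 1) delta x) <= B.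
Proof.
  intros Hr; assert (H := ex_series_prabhakar_coef r Hr).
  assert (Hb : forall x, Cmod x <= r ->
     Cmod (Cprabhakar sigma (tau + 1) delta x)
       <= 2 * Series (fun k => Cmod (prabhakar_coef k) * r ^ k)).
  { intros x Hx.
    assert (Ht : forall k, Cmod (prabhakar_coef k * x ^ k)%C <= Cmod (prabhakar_coef k) * r ^ k).
    { intros k; rewrite Cmod_mult, Cmod_pow.
      apply Rmult_le_compat_l; [apply Cmod_ge_0|].
      apply pow_incr; split; [apply Cmod_ge_0 | easy]. }
    eapply Rle_trans; [apply Cmod_CSeries_le|].
    - exact (ex_series_Cmod_le (fun k => prabhakar_coef k * x ^ k)%C _ Ht H).
    - apply Rmult_le_compat_l; [lra|].
      apply Series_le; [|exact H].
      intros k; split; [apply Cmod_ge_0 | apply Ht]. }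
  exists (2 * Series (fun k => Cmod (prabhakar_coef k) * r ^ k)); split; [|exact Hb].
  apply Rle_trans with (2 := Hb (RtoC 0) ltac:(rewrite Cmod_0; exact Hr)), Cmod_ge_0.
Qed.

Lemma prabhakar_exp_summable : exp_summable prabhakar_exp_coef prabhakar_exponent.
Proof.
  intros B HB.
  (* Since [|mu_k| <= |sigma| k + |tau|], the exponential weight is geometric in [k] up to a
     constant; [r] is its ratio combined with that of [lambda ^ k]. *)
  set (r := Cmod lambda * exp (Cmod sigma * B)).
  assert (Hr : 0 <= r) by (apply Rmult_le_pos; [apply Cmod_ge_0 | apply Rlt_le, exp_pos]).
  apply (@ex_series_le R_AbsRing R_CompleteNormedModule)
    with (b := fun k => exp (Cmod tau * B) * (Cmod (prabhakar_coef k) * r ^ k)).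
  2: { apply (ex_series_scal_l (exp (Cmod tau * B)) (fun k => Cmod (prabhakar_coef k) * r ^ k)).
       now apply ex_series_prabhakar_coef. }
  intros k; change (norm ?x) with (Rabs x).
  rewrite Rabs_pos_eq by (apply Rmult_le_pos; [apply Cmod_ge_0 | apply Rlt_le, exp_pos]).
  unfold prabhakar_exp_coef; rewrite Cmod_mult, Cmod_pow.
  apply Rle_trans with (Cmod (prabhakar_coef k) * Cmod lambda ^ k *
     (exp (INR k * (Cmod sigma * B)) * exp (Cmod tau * B))).
  - apply Rmult_le_compat_l.
    { apply Rmult_le_pos; [apply Cmod_ge_0 | apply pow_le, Cmod_ge_0]. }
    rewrite <- exp_plus; apply exp_le.
    unfold prabhakar_exponent.
    assert (H := Cmod_triangle (sigma * RtoC (INR k)) tau).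
    rewrite Cmod_mult, Cmod_R, Rabs_pos_eq in H by apply pos_INR.
    nra.
  - unfold r; rewrite Rpow_mult_distr.
    assert (E : exp (INR k * (Cmod sigma * B)) = exp (Cmod sigma * B) ^ k).
    { rewrite <- Rpower_pow by apply exp_pos; unfold Rpower; now rewrite ln_exp. }
    rewrite E; right; ring.
Qed.

Lemma prabhakar_exp_term (k : nat) (l : C) :
  ((lambda * Cexp (sigma * l)) ^ k)%C
  = (Cexp (- (tau * l)) * (lambda ^ k * Cexp (prabhakar_exponent k * l)))%C.
Proof.
  rewrite Cpow_mult_l, Cexp_pow.
  replace (RtoC (INR k) * (sigma * l))%C with (- (tau * l) + prabhakar_exponent k * l)%C
    by (unfold prabhakar_exponent; ring).
  rewrite Cexp_plus; ring.
Qed.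

Lemma Cprabhakar_plus_1_exp (l : C) :
  Cprabhakar sigma (tau + 1) delta (lambda * Cexp (sigma * l))%C
  = (Cexp (- (tau * l)) * exp_series prabhakar_exp_coef prabhakar_exponent l)%C.
Proof.
  unfold exp_series.
  rewrite <- CSeries_scal by apply exp_summable_ex_series, prabhakar_exp_summable.
  apply CSeries_ext; intros k; rewrite prabhakar_exp_term.
  fold (prabhakar_coef k); unfold prabhakar_exp_coef; ring.
Qed.

(** Because [mu_k / Gamma (mu_k + 1) = 1 / Gamma mu_k], lowering [tau + 1] to [tau] multiplies the
    [k]-th coefficient by its exponent, exactly as differentiation in [l] does. *)
Lemma Cprabhakar_exp (l : C) :
  Cprabhakar sigma tau delta (lambda * Cexp (sigma * l))%C
  = (Cexp (- (tau * l))
      * exp_series (fun k => prabhakar_exp_coef k * prabhakar_exponent k)%C prabhakar_exponent l)%C.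
Proof.
  unfold exp_series.
  rewrite <- CSeries_scal
    by (apply exp_summable_ex_series, exp_summable_mult, prabhakar_exp_summable).
  apply CSeries_ext; intros k; rewrite prabhakar_exp_term.
  fold (prabhakar_exponent k); unfold prabhakar_exp_coef; rewrite prabhakar_coef_alt.
  assert (HG := CGamma_prabhakar_exponent_neq_0 k).
  rewrite CGamma_plus_1 in * by apply Re_prabhakar_exponent_pos.
  assert (Hm : prabhakar_exponent k <> 0%C).
  { intros E; generalize (Re_prabhakar_exponent_pos k); rewrite E; simpl; lra. }
  (* [Re mu_k] may be below 1, outside the range of the lower bound; nonvanishing is inherited from
     [mu_k + 1] through the recurrence. *)
  assert (HG' : CGamma (prabhakar_exponent k) <> 0%C).
  { intros E; apply HG; rewrite E; ring. }
  assert (HF := INR_fact_C_neq_0 k).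
  field; now repeat split.
Qed.

(** After exponentiation this reads [|t^a| <= |t|^(Re a) * exp (|Im a| M)]. *)
Lemma Re_mult_le (a l : C) (M : R) : Rabs (Im l) <= M ->
  Re (a * l)%C <= Re a * Re l + Rabs (Im a) * M.
Proof.
  intros H; change (Re (a * l)%C) with (Re a * Re l - Im a * Im l).
  assert (- (Im a * Im l) <= Rabs (Im a) * M); [|lra].
  apply Rle_trans with (1 := Rle_abs _).
  rewrite Rabs_Ropp, Rabs_mult; apply Rmult_le_compat_l; [apply Rabs_pos | easy].
Qed.

(** The point and the value of its logarithm are separate arguments, because a path may return to
    the same point on another sheet. *)
Definition prabhakar_primitive (z l : C) : C :=
  (Cpower z l tau * Cprabhakar sigma (tau + 1) delta (lambda * Cpower z l sigma))%C.

Definition prabhakar_integrand (z l : C) : C :=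
  (Cpower z l (tau - 1) * Cprabhakar sigma tau delta (lambda * Cpower z l sigma))%C.

Lemma Cpower_exp (z l eta : C) : z <> 0%C -> Cpower z l eta = Cexp (eta * l)%C.
Proof. intros H; unfold Cpower; now destruct (Ceq_dec z 0%C). Qed.

Lemma Cpower_0 (l eta : C) : Cpower 0%C l eta = 0%C.
Proof. unfold Cpower; now destruct (Ceq_dec 0%C 0%C). Qed.

Lemma prabhakar_primitive_exp (z l : C) : z <> 0%C ->
  prabhakar_primitive z l = exp_series prabhakar_exp_coef prabhakar_exponent l.
Proof.
  intros H; unfold prabhakar_primitive; rewrite !Cpower_exp by easy.
  rewrite Cprabhakar_plus_1_exp, Cexp_opp; field; apply Cexp_neq_0.
Qed.

Lemma prabhakar_integrand_exp (z l : C) : z <> 0%C ->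
  prabhakar_integrand z l =
  (Cexp (- l)
    * exp_series (fun k => prabhakar_exp_coef k * prabhakar_exponent k) prabhakar_exponent l)%C.
Proof.
  intros H; unfold prabhakar_integrand; rewrite !Cpower_exp by easy.
  rewrite Cprabhakar_exp.
  replace ((tau - 1) * l)%C with (tau * l + - l)%C by ring.
  rewrite Cexp_plus, (Cexp_opp (tau * l)); field; apply Cexp_neq_0.
Qed.

(* The bound on [Im l] keeps the argument of the Prabhakar function bounded. *)
Lemma prabhakar_primitive_small (M eps : R) : 0 < eps -> exists eta, 0 < eta /\
  forall z l, Cmod z < eta -> (z <> 0%C -> Cexp l = z /\ Rabs (Im l) <= M) ->
  Cmod (prabhakar_primitive z l) < eps.
Proof.
  intros Heps.
  set (r := Cmod lambda * exp (Rabs (Im sigma) * M)).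
  destruct (Cprabhakar_bounded r) as [B [HB Hbound]].
  { apply Rmult_le_pos; [apply Cmod_ge_0 | apply Rlt_le, exp_pos]. }
  set (C1 := exp (Rabs (Im tau) * M) * (B + 1)).
  assert (HC1 : 0 < C1) by (apply Rmult_lt_0_compat; [apply exp_pos | lra]).
  (* Below 1, [Re l < 0] keeps [lambda t^sigma] in the disc of radius [r]; below the second value,
     [|z|^(Re tau) * C1 < eps]. *)
  exists (Rmin 1 (exp (ln (eps / C1) / Re tau))); split.
  { apply Rmin_pos; [lra | apply exp_pos]. }
  intros z l Hz Hl.
  destruct (Ceq_dec z 0%C) as [->|Hz0].
  { unfold prabhakar_primitive; rewrite Cpower_0, Cmult_0_l, Cmod_0; exact Heps. }
  destruct (Hl Hz0) as [El HM].
  unfold prabhakar_primitive; rewrite !Cpower_exp by easy.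
  rewrite <- El, Cmod_Cexp in Hz.
  assert (H1 : Re l < 0).
  { apply exp_lt_inv; rewrite exp_0; apply Rlt_le_trans with (1 := Hz), Rmin_l. }
  assert (H2 : Re l < ln (eps / C1) / Re tau).
  { apply exp_lt_inv, Rlt_le_trans with (1 := Hz), Rmin_r. }
  apply (proj2 (Rlt_div_r _ _ _ Htau)) in H2.
  rewrite Cmod_mult, Cmod_Cexp.
  apply Rle_lt_trans with (exp (Re tau * Re l) * C1).
  - unfold C1; rewrite <- Rmult_assoc, <- exp_plus.
    apply Rmult_le_compat; [apply Rlt_le, exp_pos | apply Cmod_ge_0 | |].
    + now apply exp_le, Re_mult_le.
    + apply Rle_trans with B; [|lra].
      apply Hbound; unfold r; rewrite Cmod_mult, Cmod_Cexp.
      apply Rmult_le_compat_l; [apply Cmod_ge_0|].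
      apply exp_le; generalize (Re_mult_le sigma l M HM); nra.
  - apply Rlt_div_r; [easy|].
    rewrite <- (exp_ln (eps / C1)) by now apply Rdiv_lt_0_compat.
    apply exp_increasing; lra.
Qed.

Lemma prabhakar_arc_derive (g l : R -> C) (s : R) (v : C) :
  locally s (fun t => g t <> 0%C /\ Cexp (l t) = g t) ->
  filterlim l (locally s) (locally (l s)) ->
  @is_derive R_AbsRing C_R_NormedModule g s v ->
  @is_derive R_AbsRing C_R_NormedModule (fun t => prabhakar_primitive (g t) (l t)) s
    (prabhakar_integrand (g s) (l s) * v)%C.
Proof.
  intros Hloc Hl Hg.
  destruct (locally_singleton _ _ Hloc) as [Hs0 Hs].
  apply (is_derive_ext_loc (fun t => exp_series prabhakar_exp_coef prabhakar_exponent (l t))).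
  { generalize Hloc; apply filter_imp; intros t [H _]; now rewrite prabhakar_primitive_exp. }
  rewrite prabhakar_integrand_exp by exact Hs0.
  (* The factor [Cexp (- l)] of the integrand is the [1/g] in [l' = g'/g]. *)
  replace (_ * _ * v)%C
    with (exp_series (fun k => prabhakar_exp_coef k * prabhakar_exponent k)%C prabhakar_exponent (l s)
           * (v / Cexp (l s)))%C.
  2: { rewrite Cexp_opp; field; apply Cexp_neq_0. }
  apply is_derive_quadratic_comp; [apply exp_series_quadratic, prabhakar_exp_summable|].
  apply is_derive_log; [exact Hl|].
  apply (is_derive_ext_loc g); [|exact Hg].
  generalize Hloc; apply filter_imp; intros t [_ H]; now rewrite H.
Qed.

Lemma prabhakar_arc_continuous (g l v : R -> C) (s : R) :
  locally s (fun t => g t <> 0%C) ->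
  filterlim l (locally s) (locally (l s)) ->
  filterlim v (locally s) (locally (v s)) ->
  filterlim (fun t => prabhakar_integrand (g t) (l t) * v t)%C
    (locally s) (locally (prabhakar_integrand (g s) (l s) * v s)%C).
Proof.
  intros Hloc Hl Hv.
  assert (Hs := locally_singleton _ _ Hloc).
  apply filterlim_Cmult; [apply locally_filter | | exact Hv].
  rewrite prabhakar_integrand_exp by exact Hs.
  apply filterlim_ext_loc with (fun t => Cexp (- l t)
    * exp_series (fun k => prabhakar_exp_coef k * prabhakar_exponent k)%C prabhakar_exponent (l t))%C.
  { generalize Hloc; apply filter_imp; intros t H; now rewrite prabhakar_integrand_exp. }
  apply filterlim_Cmult; [apply locally_filter | |].
  - apply (quadratic_at_filterlim _ Cexp _ _ (fun t => - l t)%C (Cexp_quadratic _)).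
    exact (filterlim_comp _ _ _ _ Copp _ _ _ Hl (filterlim_opp (V := C_NormedModule) (l s))).
  - apply (quadratic_at_filterlim _ _ _ _ _
      (exp_series_quadratic _ _ _ (exp_summable_mult _ _ prabhakar_exp_summable)) Hl).
Qed.

End Prabhakar.

(** * Improper integrals over the arcs of a path *)

Lemma is_RInt_gen_primitive (f F : R -> C) (a b : R) (A B : C) : a < b ->
  (forall s, a < s < b -> @is_derive R_AbsRing C_R_NormedModule F s (f s)) ->
  (forall s, a < s < b -> filterlim f (locally s) (locally (f s))) ->
  filterlim F (at_right a) (locally A) ->
  filterlim F (at_left b) (locally B) ->
  @is_RInt_gen C_R_NormedModule f (at_right a) (at_left b) (B - A)%C.
Proof.
  intros Hab Hd Hc HA HB P HP.
  assert (L : filterlim (fun x => F (snd x) - F (fst x))%C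
                (filter_prod (at_right a) (at_left b)) (locally (B - A)%C)).
  { apply (filterlim_comp_2 (fun x : R * R => F (snd x)) (fun x => - F (fst x))%C Cplus
      (G := locally B) (H := locally (- A)%C)).
    - exact (filterlim_comp _ _ _ snd F _ _ _ filterlim_snd HB).
    - exact (filterlim_comp _ _ _ _ Copp _ _ _ (filterlim_comp _ _ _ fst F _ _ _ filterlim_fst HA)
        (filterlim_opp (V := C_NormedModule) A)).
    - exact (filterlim_plus (V := C_NormedModule) B (- A)%C). }
  assert (E : filter_prod (at_right a) (at_left b) (fun x => a < fst x < b /\ a < snd x < b)).
  { assert (Hp : 0 < b - a) by lra.
    exists (fun u => a < u < b) (fun u => a < u < b); [| | easy].
    - exists (mkposreal _ Hp); intros y Hy Hy'.
      change (Rabs (y - a) < b - a) in Hy; apply Rabs_def2 in Hy; lra.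
    - exists (mkposreal _ Hp); intros y Hy Hy'.
      change (Rabs (y - b) < b - a) in Hy; apply Rabs_def2 in Hy; lra. }
  assert (L1 := L P HP); unfold filtermap in L1; unfold filtermapi.
  generalize (filter_and _ _ L1 E); apply filter_imp.
  intros [u v] [H1 [H2 H3]]; cbn [fst snd] in *.
  exists (F v - F u)%C; split; [|exact H1].
  (* The integrand may be singular at [a] and [b], so the fundamental theorem is applied only
     between [u] and [v], in either order, inside the open interval. *)
  assert (Hin : forall x, Rmin u v <= x <= Rmax u v -> a < x < b).
  { intros x [Hx1 Hx2]; split.
    - apply Rlt_le_trans with (2 := Hx1), Rmin_glb_lt; lra.
    - apply Rle_lt_trans with (1 := Hx2), Rmax_lub_lt; lra. }
  apply (is_RInt_derive (V := C_R_CompleteNormedModule) F f).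
  - intros x Hx; now apply Hd, Hin.
  - intros x Hx; now apply Hc, Hin.
Qed.

Section PathIntegral.

Context {z : C} (g : path 0%C z) (l : R -> C).
Hypothesis Hl : log_branch g l.
Variables sigma tau delta lambda : C.
Hypothesis Hsigma : 0 < Re sigma.
Hypothesis Htau : 0 < Re tau.

Let Phi (s : R) : C := prabhakar_primitive sigma tau delta lambda (g s) (l s).

Lemma knot_bounds (k : nat) : (k <= narcs _ _ g)%nat ->
  0 <= knot _ _ g k <= 1.
Proof.
  intros Hk; split.
  - induction k as [|k IH]; [rewrite knot_first; lra|].
    assert (H := knot_incr _ _ g k Hk). specialize (IH ltac:(lia)); lra.
  (* Descending induction from the last knot. *)
  - assert (H : forall j, (j <= narcs _ _ g)%nat ->
        knot _ _ g (narcs _ _ g - j) <= 1).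
    { induction j as [|j IH]; intros Hj.
      - rewrite Nat.sub_0_r, knot_last; lra.
      - assert (H := knot_incr _ _ g (narcs _ _ g - S j) ltac:(lia)).
        replace (S (narcs _ _ g - S j)) with (narcs _ _ g - j)%nat in H by lia.
        specialize (IH ltac:(lia)); lra. }
    replace k with (narcs _ _ g - (narcs _ _ g - k))%nat by lia.
    apply H; lia.
Qed.

Lemma prabhakar_primitive_path_continuous : continuous_on (fun s => 0 <= s <= 1) Phi.
Proof.
  intros s Hs.
  assert (Hg := path_cont _ _ g s Hs).
  assert (HF : Filter (within (fun s : R_UniformSpace => 0 <= s <= 1) (locally s)))
    by (apply within_filter, locally_filter).
  destruct (Ceq_dec (g s) 0%C) as [H0|H0].
  - unfold Phi at 2; rewrite H0; unfold prabhakar_primitive; rewrite Cpower_0, Cmult_0_l.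
    apply filterlim_Cmod; [exact HF|]; intros eps.
    destruct (log_branch_bounded _ _ Hl) as [M HM].
    destruct (prabhakar_primitive_small sigma tau delta lambda Hsigma Htau M eps (cond_pos eps))
      as [eta [Heta H]].
    generalize (proj1 (filterlim_Cmod _ _ _) Hg (mkposreal _ Heta)).
    unfold within; apply filter_imp; intros t Ht Ht1.
    specialize (Ht Ht1); rewrite H0 in Ht; cbn [pos] in Ht.
    replace (g t - 0)%C with (g t) in Ht by ring.
    replace (Phi t - 0)%C with (Phi t) by ring.
    apply H; [exact Ht|]; intros Hgt; split.
    + now apply (log_branch_exp _ _ Hl).
    + now apply HM.
  - assert (Hnz : within (fun s : R_UniformSpace => 0 <= s <= 1) (locally s)
              (fun t => g t <> 0%C)).
    { generalize (proj1 (filterlim_Cmod _ _ _) Hg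
         (mkposreal _ (proj1 (Cmod_gt_0 _) H0))).
      apply filter_imp; intros t Ht E; cbn [pos] in Ht; rewrite E in Ht.
      replace (0 - g s)%C with (- g s)%C in Ht by ring; rewrite Cmod_opp in Ht; lra. }
    assert (Hlc : filterlim l (within (fun s : R_UniformSpace => 0 <= s <= 1) (locally s))
              (locally (l s))).
    (* The branch is continuous relative to the set where [g] is nonzero; near [s] this restriction
       is automatic. *)
    { intros P HP.
      assert (H := log_branch_cont _ _ Hl s (conj Hs H0) P HP).
      unfold filtermap, within in *.
      generalize (filter_and _ _ Hnz H); apply filter_imp.
      intros t [H1 H2] H3; apply H2; split; auto. }
    unfold Phi at 2; rewrite prabhakar_primitive_exp by easy.
    apply filterlim_ext_loc
      with (fun t => exp_series (prabhakar_exp_coef sigma tau delta lambda)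
                       (prabhakar_exponent sigma tau) (l t)).
    + revert Hnz; apply filter_imp; intros t Ht; symmetry; now apply prabhakar_primitive_exp.
    + eapply quadratic_at_filterlim; [exact HF | | exact Hlc].
      now apply exp_series_quadratic, prabhakar_exp_summable.
Qed.

Lemma prabhakar_arc_integral (k : nat) : (k < narcs _ _ g)%nat ->
  @is_RInt_gen C_R_NormedModule
    (fun s => prabhakar_integrand sigma tau delta lambda (g s) (l s) * velocity _ _ g k s)%C
    (at_right (knot _ _ g k)) (at_left (knot _ _ g (S k)))
    (Phi (knot _ _ g (S k)) - Phi (knot _ _ g k))%C.
Proof.
  intros Hk.
  assert (Ha := knot_bounds k ltac:(lia)); assert (Hb := knot_bounds (S k) Hk).
  assert (Hab := knot_incr _ _ g k Hk).
  assert (Hvel := velocity_cont _ _ g k Hk).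
  assert (Hder := fun s => path_derive _ _ g k s Hk).
  assert (Hz := log_branch_zeros _ _ Hl k Hk).
  set (a := knot _ _ g k) in *; set (b := knot _ _ g (S k)) in *.
  assert (Hloc : forall s, a < s < b -> locally s (fun t => a < t < b)).
  { intros s Hs; apply (locally_interval _ s a b); simpl; [apply Hs | apply Hs | easy]. }
  assert (Hv : forall s, a < s < b ->
     filterlim (velocity _ _ g k) (locally s) (locally (velocity _ _ g k s))).
  { intros s Hs; apply (continuous_continuous_on (fun t : R_UniformSpace => a <= t <= b));
      [|exact Hvel].
    generalize (Hloc s Hs); apply filter_imp; intros t Ht; simpl; lra. }
  apply (is_RInt_gen_primitive _ Phi); [exact Hab | | | |].
  - intros s Hs; destruct Hz as [Hz|Hz].
    + apply prabhakar_arc_derive; [exact Hsigma | exact Htau | | | now apply Hder].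
      * generalize (Hloc s Hs); apply filter_imp; intros t Ht.
        split; [now apply Hz|]; apply (log_branch_exp _ _ Hl); [lra | now apply Hz].
      * apply (continuous_continuous_on (fun t : R_UniformSpace => 0 <= t <= 1 /\ g t <> 0%C));
          [|apply (log_branch_cont _ _ Hl)].
        generalize (Hloc s Hs); apply filter_imp; intros t Ht.
        split; [simpl; lra | now apply Hz].
    (* On an arc resting at [0], primitive and integrand both vanish by the value of [Cpower] at
       [0]. *)
    + unfold prabhakar_integrand; rewrite (Hz s Hs), Cpower_0, !Cmult_0_l.
      apply (is_derive_ext_loc (V := C_R_NormedModule) (fun _ => RtoC 0)).
      * generalize (Hloc s Hs); apply filter_imp; intros t Ht.
        unfold Phi, prabhakar_primitive; now rewrite (Hz t Ht), Cpower_0, Cmult_0_l.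
      * apply (is_derive_const (V := C_R_NormedModule)).
  - intros s Hs; destruct Hz as [Hz|Hz].
    + apply (prabhakar_arc_continuous _ _ _ _ Hsigma Htau); [| | now apply Hv].
      * generalize (Hloc s Hs); apply filter_imp; intros t Ht; now apply Hz.
      * apply (continuous_continuous_on (fun t : R_UniformSpace => 0 <= t <= 1 /\ g t <> 0%C));
          [|apply (log_branch_cont _ _ Hl)].
        generalize (Hloc s Hs); apply filter_imp; intros t Ht.
        split; [simpl; lra | now apply Hz].
    + unfold prabhakar_integrand at 2; rewrite (Hz s Hs), Cpower_0, !Cmult_0_l.
      apply filterlim_ext_loc with (fun _ => RtoC 0).
      * generalize (Hloc s Hs); apply filter_imp; intros t Ht.
        unfold prabhakar_integrand; now rewrite (Hz t Ht), Cpower_0, !Cmult_0_l.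
      * apply filterlim_const.
  (* Points just to the right of [a] lie in the arc, hence in [[0,1]], so continuity relative to
     [[0,1]] yields the one-sided limit. *)
  - intros P HP.
    assert (H := prabhakar_primitive_path_continuous a Ha P HP).
    unfold filtermap, at_right, within in *.
    assert (Hp : 0 < b - a) by lra.
    generalize (filter_and _ _ H (locally_ball a (mkposreal _ Hp))); apply filter_imp.
    intros t [H1 H2] H3; apply H1.
    change (Rabs (t - a) < b - a) in H2; apply Rabs_def2 in H2; simpl; lra.
  - intros P HP.
    assert (H := prabhakar_primitive_path_continuous b Hb P HP).
    unfold filtermap, at_left, within in *.
    assert (Hp : 0 < b - a) by lra.
    generalize (filter_and _ _ H (locally_ball b (mkposreal _ Hp))); apply filter_imp.
    intros t [H1 H2] H3; apply H1.
    change (Rabs (t - b) < b - a) in H2; apply Rabs_def2 in H2; simpl; lra.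
Qed.

Lemma prabhakar_path_integral :
  is_path_integral g (fun s => prabhakar_integrand sigma tau delta lambda (g s) (l s))
    (prabhakar_primitive sigma tau delta lambda z (l 1)).
Proof.
  exists (fun k => Phi (knot _ _ g (S k)) - Phi (knot _ _ g k))%C; split.
  - exact prabhakar_arc_integral.
  - assert (H : forall n, Csum n (fun k => Phi (knot _ _ g (S k)) - Phi (knot _ _ g k))%C
              = (Phi (knot _ _ g n) - Phi (knot _ _ g 0%nat))%C).
    { induction n as [|n IH]; simpl; [|rewrite IH]; ring. }
    rewrite H, knot_first, knot_last; unfold Phi.
    rewrite path_start, path_end.
    (* The path starts at [0], where [Phi] vanishes; only the end value survives the telescoping. *)
    unfold prabhakar_primitive at 3; rewrite Cpower_0; ring.
Qed.

End PathIntegral.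

(** * Reduction to idempotent components *)

Lemma Bcomp_pow (x : bicomplex) (k : nat) :
  Bcomp1 (Bpow x k) = (Bcomp1 x ^ k)%C /\ Bcomp2 (Bpow x k) = (Bcomp2 x ^ k)%C.
Proof.
  induction k as [|k [IH1 IH2]].
  - split; [apply Bcomp1_R | apply Bcomp2_R].
  - simpl Bpow; rewrite Bcomp1_mult, Bcomp2_mult, IH1, IH2; now split.
Qed.

Lemma Bcomp_pochhammer (x : bicomplex) (k : nat) :
  Bcomp1 (Bpochhammer x k) = Cpochhammer (Bcomp1 x) k /\
  Bcomp2 (Bpochhammer x k) = Cpochhammer (Bcomp2 x) k.
Proof.
  induction k as [|k [IH1 IH2]].
  - split; [apply Bcomp1_R | apply Bcomp2_R].
  - simpl Bpochhammer.
    rewrite Bcomp1_mult, Bcomp2_mult, Bcomp1_plus, Bcomp2_plus, Bcomp1_R, Bcomp2_R, IH1, IH2.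
    now split.
Qed.

Lemma Bcomp1_prabhakar (sigma tau delta x : bicomplex) :
  Bcomp1 (prabhakar sigma tau delta x)
  = Cprabhakar (Bcomp1 sigma) (Bcomp1 tau) (Bcomp1 delta) (Bcomp1 x).
Proof.
  unfold prabhakar, BSeries; rewrite Bcomp1_idem.
  apply CSeries_ext; intros k.
  rewrite !Bcomp1_mult, (proj1 (Bcomp_pow x k)), (proj1 (Bcomp_pochhammer delta k)).
  unfold Binv, BGamma; rewrite Bcomp1_idem, Bcomp1_mult, Bcomp1_idem, Bcomp1_plus, Bcomp1_mult,
    !Bcomp1_R; reflexivity.
Qed.

Lemma Bcomp2_prabhakar (sigma tau delta x : bicomplex) :
  Bcomp2 (prabhakar sigma tau delta x)
  = Cprabhakar (Bcomp2 sigma) (Bcomp2 tau) (Bcomp2 delta) (Bcomp2 x).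
Proof.
  unfold prabhakar, BSeries; rewrite Bcomp2_idem.
  apply CSeries_ext; intros k.
  rewrite !Bcomp2_mult, (proj2 (Bcomp_pow x k)), (proj2 (Bcomp_pochhammer delta k)).
  unfold Binv, BGamma; rewrite Bcomp2_idem, Bcomp2_mult, Bcomp2_idem, Bcomp2_plus, Bcomp2_mult,
    !Bcomp2_R; reflexivity.
Qed.

(** The components have real parts [x0 + x3] and [x0 - x3], so the bicomplex condition puts both in
    the right half-plane. *)
Lemma Re_Bcomp_pos (x : bicomplex) : Rabs (Bimj x) < Bre x ->
  0 < Re (Bcomp1 x) /\ 0 < Re (Bcomp2 x).
Proof.
  intros H; apply Rabs_def2 in H.
  unfold Bcomp1, Bcomp2, Bw1, Bw2, Re; simpl; lra.
Qed.

Theorem theorem3p4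
  (sigma tau delta zeta lambda : bicomplex)
  (hsigma : Rabs (Bimj sigma) < Bre sigma)
  (htau : Rabs (Bimj tau) < Bre tau)
  (hdelta : Rabs (Bimj delta) < Bre delta)
  (g1 : path 0%C (Bcomp1 zeta)) (g2 : path 0%C (Bcomp2 zeta))
  (l1 l2 : R -> C)
  (hl1 : log_branch g1 l1) (hl2 : log_branch g2 l2) :
  is_bicomplex_integral g1 g2
    (fun s =>
       let t := Bidem (g1 s) (g2 s) in
       let logt := Bidem (l1 s) (l2 s) in
       (Bpower t logt (tau - Bone)
          * prabhakar sigma tau delta (lambda * Bpower t logt sigma))%T)
    (let logzeta := Bidem (l1 1) (l2 1) in
     (Bpower zeta logzeta tau
        * prabhakar sigma (tau + Bone) delta (lambda * Bpower zeta logzeta sigma))%T).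
Proof.
  destruct (Re_Bcomp_pos _ hsigma) as [Hs1 Hs2]; destruct (Re_Bcomp_pos _ htau) as [Ht1 Ht2].
  exists (prabhakar_primitive (Bcomp1 sigma) (Bcomp1 tau) (Bcomp1 delta) (Bcomp1 lambda)
            (Bcomp1 zeta) (l1 1)),
         (prabhakar_primitive (Bcomp2 sigma) (Bcomp2 tau) (Bcomp2 delta) (Bcomp2 lambda)
            (Bcomp2 zeta) (l2 1)).
  assert (E1 : forall s, Bcomp1 (Bpower (Bidem (g1 s) (g2 s)) (Bidem (l1 s) (l2 s)) (tau - Bone)
      * prabhakar sigma tau delta
          (lambda * Bpower (Bidem (g1 s) (g2 s)) (Bidem (l1 s) (l2 s)) sigma))%T
    = prabhakar_integrand (Bcomp1 sigma) (Bcomp1 tau) (Bcomp1 delta) (Bcomp1 lambda) (g1 s) (l1 s)).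
  { intros s; rewrite Bcomp1_mult, Bcomp1_prabhakar, Bcomp1_mult; unfold Bpower.
    rewrite !Bcomp1_idem, Bcomp1_minus; unfold Bone; now rewrite Bcomp1_R. }
  assert (E2 : forall s, Bcomp2 (Bpower (Bidem (g1 s) (g2 s)) (Bidem (l1 s) (l2 s)) (tau - Bone)
      * prabhakar sigma tau delta
          (lambda * Bpower (Bidem (g1 s) (g2 s)) (Bidem (l1 s) (l2 s)) sigma))%T
    = prabhakar_integrand (Bcomp2 sigma) (Bcomp2 tau) (Bcomp2 delta) (Bcomp2 lambda) (g2 s) (l2 s)).
  { intros s; rewrite Bcomp2_mult, Bcomp2_prabhakar, Bcomp2_mult; unfold Bpower.
    rewrite !Bcomp2_idem, Bcomp2_minus; unfold Bone; now rewrite Bcomp2_R. }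
  split; [|split].
  - destruct (prabhakar_path_integral g1 l1 hl1 _ _ (Bcomp1 delta) (Bcomp1 lambda) Hs1 Ht1)
      as [I [HI HS]].
    exists I; split; [|exact HS]; intros k Hk.
    apply is_RInt_gen_ext with (2 := HI k Hk).
    apply filter_forall; intros x y _; cbv zeta; now rewrite E1.
  - destruct (prabhakar_path_integral g2 l2 hl2 _ _ (Bcomp2 delta) (Bcomp2 lambda) Hs2 Ht2)
      as [I [HI HS]].
    exists I; split; [|exact HS]; intros k Hk.
    apply is_RInt_gen_ext with (2 := HI k Hk).
    apply filter_forall; intros x y _; cbv zeta; now rewrite E2.
  - cbv zeta; rewrite <- (Bidem_comp (_ * _)%T); f_equal.
    + rewrite Bcomp1_mult, Bcomp1_prabhakar, Bcomp1_plus, Bcomp1_mult; unfold Bpower, Bone.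
      now rewrite !Bcomp1_idem, Bcomp1_R.
    + rewrite Bcomp2_mult, Bcomp2_prabhakar, Bcomp2_plus, Bcomp2_mult; unfold Bpower, Bone.
      now rewrite !Bcomp2_idem, Bcomp2_R.
Qed.
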